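(* Let $Az=b$ be a system of $m$ linear equations over $\mathbb{F}_2$ in the variables $z_1,\dots,z_n$, where each equation has a positive real weight, such that $\mathrm{rank}\,A=n$ and no two equations have the same left-hand side (i.e., the same set of variables). Let $w_{\min}$ be the minimum weight of an equation and let $k\ge 2$ be an integer. If $k\le m\le 2^{n/(k-1)}-2$, then the maximum excess of $Az=b$ is at least $k\cdot w_{\min}$. Moreover, an assignment achieving excess at least $k\cdot w_{\min}$ can be found in time $m^{O(1)}$.
   Context: The excess of an assignment $z\in\mathbb{F}_2^n$ is the total weight of the satisfied equations minus the total weight of the falsified equations; the maximum excess is the maximum of the excess over all assignments. (A system with $\mathrm{rank}\,A=n$ and no two equations with the same left-hand side is called irreducible in the paper.)
   Formalization: Every equation is additionally required to contain at least one variable (no zero row of A); otherwise an equation 0 = 1 of large weight makes every excess negative and the claim fails. *)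

(* Defs.v *)
From HB Require Import structures.
From mathcomp Require Import all_boot all_order all_algebra.
From mathcomp Require Import all_classical all_reals all_analysis.

Set Implicit Arguments.
Unset Strict Implicit.
Unset Printing Implicit Defensive.

Import Order.TTheory GRing.Theory Num.Theory.
Local Open Scope ring_scope.

Record lin_system (R : realType) (n m : nat) := LinSystem {
  lhs : 'M['F_2]_(m, n);
  rhs : 'cV['F_2]_m;
  weight : 'I_m -> R
}.

Definition positive_weights (R : realType) n m (S : lin_system R n m) : Prop :=
  forall i, 0 < weight S i.

(* An equation is "sum_(j in I) z_j = b_I" with I a nonempty set of variables,
   whence the nonzero rows: an equation 0 = 1 is falsified by every assignment
   and may carry an arbitrarily large weight. *)
Definition irreducible (R : realType) n m (S : lin_system R n m) : Prop :=
  [/\ \rank (lhs S) = n,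
      forall i, row i (lhs S) != 0
    & injective (fun i => row i (lhs S))].

Definition is_min_weight (R : realType) n m (S : lin_system R n m) (x : R) :=
  (exists i, weight S i = x) /\ (forall i, x <= weight S i).

Definition satisfied (R : realType) n m (S : lin_system R n m)
    (z : 'cV['F_2]_n) (i : 'I_m) : bool :=
  (lhs S *m z) i 0 == rhs S i 0.

Definition excess (R : realType) n m (S : lin_system R n m)
    (z : 'cV['F_2]_n) : R :=
  \sum_(i | satisfied S z i) weight S i
    - \sum_(i | ~~ satisfied S z i) weight S i.

(* The index value [excess S 0] is itself one of the values maximised over. *)
Definition max_excess (R : realType) n m (S : lin_system R n m) : R :=
  \big[Num.max/excess S 0]_(z : 'cV['F_2]_n) excess S z.

(* Model of computation: programs over finitely many unbounded arrays of
   natural numbers and finitely many unbounded arrays of reals.  Integer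
   multiplication is absent, so the integers computed in t steps have O(t)
   bits; reals can only be copied, added, subtracted and compared, and there
   are no real constants.  Running time in this model is therefore
   polynomially related to Turing machine time when the weights are integers
   (with the bit size of the weights counted). *)
Inductive nexp : Type :=
  | NConst of nat
  | NGet of nat & nexp            (* NGet a e is the cell e of array a *)
  | NAdd of nexp & nexp
  | NSub of nexp & nexp.          (* truncated subtraction *)

Inductive rexp : Type :=
  | RGet of nat & nexp
  | RAdd of rexp & rexp
  | RSub of rexp & rexp.

Inductive bexp : Type :=
  | NLe of nexp & nexp
  | RLe of rexp & rexp
  | BNot of bexp
  | BAnd of bexp & bexp.

Inductive cmd : Type :=
  | Skip
  | NSet of nat & nexp & nexp     (* NSet a e v writes v in cell e of array a *)
  | RSet of nat & nexp & rexp
  | Seq of cmd & cmd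
  | If of bexp & cmd & cmd
  | While of bexp & cmd.

Record state (R : realType) := State {
  nmem : nat -> nat -> nat;       (* array name, then cell index *)
  rmem : nat -> nat -> R
}.

Definition update (T : Type) (f : nat -> nat -> T) (a p : nat) (v : T) :=
  fun a' p' => if (a' == a) && (p' == p) then v else f a' p'.

Section Semantics.
Variable R : realType.
Implicit Type s : state R.

Fixpoint neval s (e : nexp) : nat :=
  match e with
  | NConst c => c
  | NGet a e1 => nmem s a (neval s e1)
  | NAdd e1 e2 => (neval s e1 + neval s e2)%N
  | NSub e1 e2 => (neval s e1 - neval s e2)%N
  end.

Fixpoint reval s (e : rexp) : R :=
  match e with
  | RGet a e1 => rmem s a (neval s e1)
  | RAdd e1 e2 => reval s e1 + reval s e2
  | RSub e1 e2 => reval s e1 - reval s e2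
  end.

Fixpoint beval s (e : bexp) : bool :=
  match e with
  | NLe e1 e2 => (neval s e1 <= neval s e2)%N
  | RLe e1 e2 => reval s e1 <= reval s e2
  | BNot e1 => ~~ beval s e1
  | BAnd e1 e2 => beval s e1 && beval s e2
  end.

(* [exec c s t s']: started in [s], the program [c] halts in [s'] after [t]
   steps.  An assignment or a test counts for one step: the expressions of a
   fixed program have bounded size. *)
Inductive exec : cmd -> state R -> nat -> state R -> Prop :=
  | ExecSkip s : exec Skip s 1 s
  | ExecNSet a e v s :
      exec (NSet a e v) s 1
        (State (update (nmem s) a (neval s e) (neval s v)) (rmem s))
  | ExecRSet a e v s :
      exec (RSet a e v) s 1
        (State (nmem s) (update (rmem s) a (neval s e) (reval s v)))
  | ExecSeq c1 c2 s s1 s2 t1 t2 :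
      exec c1 s t1 s1 -> exec c2 s1 t2 s2 ->
      exec (Seq c1 c2) s (t1 + t2) s2
  | ExecIfTrue b c1 c2 s s1 t :
      beval s b -> exec c1 s t s1 -> exec (If b c1 c2) s t.+1 s1
  | ExecIfFalse b c1 c2 s s1 t :
      ~~ beval s b -> exec c2 s t s1 -> exec (If b c1 c2) s t.+1 s1
  | ExecWhileTrue b c s s1 s2 t1 t2 :
      beval s b -> exec c s t1 s1 -> exec (While b c) s1 t2 s2 ->
      exec (While b c) s (t1 + t2).+1 s2
  | ExecWhileFalse b c s :
      ~~ beval s b -> exec (While b c) s 1 s.

Lemma exec_det c s t1 s1 t2 s2 :
  exec c s t1 s1 -> exec c s t2 s2 -> t1 = t2 /\ s1 = s2.
Proof.
move=> H; elim: H t2 s2 => {c s t1 s1}; intros;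
  match goal with H : exec ?c _ _ _ |- _ =>
    match goal with |- _ /\ _ = ?s' =>
      match type of H with exec _ _ _ s' => inversion H; subst; clear H end
    end
  end => //;
  try match goal with H1 : is_true ?b, H2 : is_true (~~ ?b) |- _ =>
    by rewrite H1 in H2
  end;
  repeat match goal with
    IH : forall t s, exec ?c ?s0 t s -> _ , H : exec ?c ?s0 _ _ |- _ =>
      case: (IH _ _ H) => ? ?; subst; clear IH
  end => //.
Qed.

(* Input: n, m, k in array 0, the matrix in array 1 in row-major order, the
   right-hand sides in array 2 and the weights in the real array 0; every
   other cell holds 0. *)
Definition input_state n m (S : lin_system R n m) (k : nat) : state R :=
  State
    (fun a p => match a with
       | 0%N => nth 0%N [:: n; m; k] p
       | 1%N => match (insub (p %/ n)%N : option 'I_m),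
                      (insub (p %% n)%N : option 'I_n) with
                | Some i, Some j => nat_of_ord (lhs S i j)
                | _, _ => 0%N
                end
       | 2%N => if (insub p : option 'I_m) is Some i
                then nat_of_ord (rhs S i 0) else 0%N
       | _ => 0%N
       end)
    (fun a p => match a with
       | 0%N => if (insub p : option 'I_m) is Some i then weight S i else 0
       | _ => 0
       end).

(* Output: the assignment, in the first n cells of array 3. *)
Definition outputs n (s : state R) (z : 'cV['F_2]_n) : Prop :=
  forall j : 'I_n, nmem s 3 j = nat_of_ord (z j 0).

End Semantics.

(* Main.v *)
Require Import Defs.
From HB Require Import structures.
From mathcomp Require Import all_boot all_order all_algebra.
From mathcomp Require Import all_classical all_reals all_analysis.
From mathcomp Require Import zify.

(** Call a list of rows of [A] sum-free if no sum of two or more of them is a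
    row of [A].  Satisfy the equations of a sum-free list one after the other,
    each time eliminating a variable from all equations: the rows which become
    zero together with a listed row are those congruent to it modulo the
    previous ones, so it is alone and its weight is won for good.  Eliminating
    with any other row, the right-hand side can be chosen so that the total
    signed weight of the rows which become zero is nonnegative.  Hence a
    sum-free list of [k] rows yields an assignment of excess at least
    [k * wmin].

    Such a list is found in rounds.  A round works modulo the span [U] of the
    rows used in the previous rounds, and scans the rows once, picking a row
    [a] outside the span [D] of [U] and the picked rows if every row congruent
    to [a] modulo [D] is already congruent to [a] modulo [U]; the picked rows
    are then sum-free.  If a round stops with fewer than [k] rows, every class
    modulo [D] contains at least two classes modulo [U], so the number of
    classes is halved while the dimension drops by at most [k - 1]; as
    [(m + 2)^(k - 1) <= 2^n], this cannot go on until the dimension is 0.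

    The algorithm is written with counting loops whose bounds are constants of
    the execution, which makes both termination and the polynomial time bound
    structural. *)

Set Implicit Arguments.
Unset Strict Implicit.
Unset Printing Implicit Defensive.

Import Order.TTheory GRing.Theory Num.Theory.
Local Open Scope ring_scope.

(** * Counting loops *)

Inductive prog : Type :=
  | PSkip
  | PN of nat & nexp & nexp
  | PR of nat & nexp & rexp
  | PSeq of prog & prog
  | PIf of bexp & prog & prog
  | PFor of nat & nexp & prog.

Definition var x := NGet x (NConst 0).

Fixpoint compile (p : prog) : cmd :=
  match p with
  | PSkip => Skip
  | PN a e v => NSet a e v
  | PR a e v => RSet a e v
  | PSeq p1 p2 => Seq (compile p1) (compile p2)
  | PIf b p1 p2 => If b (compile p1) (compile p2)
  | PFor x e q =>
      Seq (NSet x (NConst 0) (NConst 0))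
        (While (BNot (NLe e (var x)))
          (Seq (compile q) (NSet x (NConst 0) (NAdd (var x) (NConst 1)))))
  end.

Fixpoint nreads (e : nexp) : seq nat :=
  match e with
  | NConst _ => [::]
  | NGet a e1 => a :: nreads e1
  | NAdd e1 e2 | NSub e1 e2 => nreads e1 ++ nreads e2
  end.

Fixpoint nwrites (p : prog) : seq nat :=
  match p with
  | PSkip | PR _ _ _ => [::]
  | PN a _ _ => [:: a]
  | PSeq p1 p2 | PIf _ p1 p2 => nwrites p1 ++ nwrites p2
  | PFor x _ q => x :: nwrites q
  end.

Fixpoint rwrites (p : prog) : seq nat :=
  match p with
  | PSkip | PN _ _ _ => [::]
  | PR a _ _ => [:: a]
  | PSeq p1 p2 | PIf _ p1 p2 => rwrites p1 ++ rwrites p2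
  | PFor _ _ q => rwrites q
  end.

Fixpoint loop_bounds (p : prog) : seq nexp :=
  match p with
  | PSkip | PN _ _ _ | PR _ _ _ => [::]
  | PSeq p1 p2 | PIf _ p1 p2 => loop_bounds p1 ++ loop_bounds p2
  | PFor _ e q => e :: loop_bounds q
  end.

(* Loop bounds read array 0 only, and array 0 is read-only: this makes all
   loop bounds constants of the execution. *)
Fixpoint well_formed (p : prog) : bool :=
  match p with
  | PSkip | PR _ _ _ => true
  | PN a _ _ => a != 0%N
  | PSeq p1 p2 | PIf _ p1 p2 => well_formed p1 && well_formed p2
  | PFor x e q =>
      [&& well_formed q, x != 0%N, x \notin nwrites q
        & all (pred1 0%N) (nreads e)]
  end.

(** [M] stands for a common bound on all loop bounds. A loop round pays two steps besides its body,
    for the test and the increment; the outer two pay for resetting the counter and for the last,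
    failing test. *)
Fixpoint cost (M : nat) (p : prog) : nat :=
  match p with
  | PSkip | PN _ _ _ | PR _ _ _ => 1
  | PSeq p1 p2 => cost M p1 + cost M p2
  | PIf _ p1 p2 => (cost M p1 + cost M p2).+1
  | PFor _ _ q => (M * (cost M q).+2).+2
  end.

(** The argument is [m + m] because the loop bounds of the algorithm are [n], [m], [k] and [m + n],
    where [n] and [k] are at most [m]. *)
Lemma cost_poly (p : prog) :
  exists c, forall m, (2 <= m)%N -> (cost (m + m) p <= m ^ c)%N.
Proof.
have key c1 c2 m : (2 <= m -> m ^ c1 <= m ^ (c1 + c2))%N.
  by move=> m2; rewrite leq_exp2l // leq_addr.
have key' c1 c2 m : (2 <= m -> m ^ c2 <= m ^ (c1 + c2))%N.
  by move=> m2; rewrite leq_exp2l // leq_addl.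
elim: p => /= [|a e v|a e v|p1 [c1 h1] p2 [c2 h2]|b p1 [c1 h1] p2 [c2 h2]|x e q [c h]].
- by exists 0%N.
- by exists 0%N.
- by exists 0%N.
- exists (c1 + c2).+1 => m m2.
  have := h1 m m2; have := h2 m m2; have := key c1 c2 m m2.
  have := key' c1 c2 m m2; rewrite expnS;
    set z := (m ^ (c1 + c2))%N => l1 l2 l3 l4.
  by apply: (@leq_trans (2 * z)); [lia|rewrite leq_mul].
- exists (c1 + c2).+2 => m m2.
  have := h1 m m2; have := h2 m m2; have := key c1 c2 m m2.
  have := key' c1 c2 m m2; have : (0 < m ^ (c1 + c2))%N.
    by rewrite expn_gt0; lia.
  rewrite !expnS; set z := (m ^ (c1 + c2))%N => z0 l1 l2 l3 l4.
  by apply: (@leq_trans (2 * (2 * z))); [lia|rewrite !leq_mul].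
(* For m >= 2: 2m(m^c + 2) + 2 <= m^c (6m + 2) <= m^c 8m <= m^(c+4). *)
- exists (c + 4)%N => m m2.
  have := h m m2; have : (0 < m ^ c)%N by rewrite expn_gt0; lia.
  rewrite expnD; set z := (m ^ c)%N; set y := cost _ _ => z0 yz.
  apply: (@leq_trans ((m + m) * (z + 2 * z) + 2 * z)); first by nia.
  have -> : ((m + m) * (z + 2 * z) + 2 * z = z * (6 * m + 2))%N by nia.
  rewrite leq_pmul2l //.
  have : (2 * (2 * (2 * m)) <= m * (m * (m * m)))%N by rewrite !leq_mul.
  by rewrite !expnS expn0 muln1; lia.
Qed.

(** * Functional semantics, invariants and compilation of counting loops *)

Section Semantics.
Variable R : realType.
Implicit Type s : state R.

Definition nset s a q v := State (update (nmem s) a q v) (rmem s).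
Definition rset s a q v := State (nmem s) (update (rmem s) a q v).

Lemma nsetE s a q v a' q' :
  nmem (nset s a q v) a' q' =
  if (a' == a) && (q' == q) then v else nmem s a' q'.
Proof. by []. Qed.

Lemma rsetE s a q v a' q' :
  rmem (rset s a q v) a' q' =
  if (a' == a) && (q' == q) then v else rmem s a' q'.
Proof. by []. Qed.

(** A loop bound is evaluated once, on entry, whereas the compiled loop evaluates it at every test;
    [well_formed] reconciles the two. *)
Fixpoint run (p : prog) (s : state R) : state R :=
  match p with
  | PSkip => s
  | PN a e v => nset s a (neval s e) (neval s v)
  | PR a e v => rset s a (neval s e) (reval s v)
  | PSeq p1 p2 => run p2 (run p1 s)
  | PIf b p1 p2 => if beval s b then run p1 s else run p2 s
  | PFor x e q =>
      iter (neval s e)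
        (fun s1 => nset (run q s1) x 0 (nmem (run q s1) x 0 + 1))
        (nset s x 0 0)
  end.

Lemma run_skip s : run PSkip s = s.
Proof. by []. Qed.

Lemma run_nset a e v s : run (PN a e v) s = nset s a (neval s e) (neval s v).
Proof. by []. Qed.

Lemma run_rset a e v s : run (PR a e v) s = rset s a (neval s e) (reval s v).
Proof. by []. Qed.

Lemma run_seq p q s : run (PSeq p q) s = run q (run p s).
Proof. by []. Qed.

Lemma run_if b p q s :
  run (PIf b p q) s = if beval s b then run p s else run q s.
Proof. by []. Qed.

Definition runE := (run_skip, run_nset, run_rset, run_seq, run_if).

Definition agree (W Wr : seq nat) s s1 :=
  (forall a q, a \notin W -> nmem s1 a q = nmem s a q) /\
  (forall a q, a \notin Wr -> rmem s1 a q = rmem s a q).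

Lemma agree_trans W Wr s s1 s2 :
  agree W Wr s s1 -> agree W Wr s1 s2 -> agree W Wr s s2.
Proof.
by move=> [h1 h2] [h3 h4]; split=> a q aW; [rewrite h3 // h1|rewrite h4 // h2].
Qed.

Lemma agree_sub W Wr W' Wr' s s1 :
  {subset W <= W'} -> {subset Wr <= Wr'} ->
  agree W Wr s s1 -> agree W' Wr' s s1.
Proof.
move=> sW sWr [h1 h2]; split=> a q aW.
  by apply: h1; apply: contra aW; apply: sW.
by apply: h2; apply: contra aW; apply: sWr.
Qed.

Lemma agree_nset W Wr s a q v : a \in W -> agree W Wr s (nset s a q v).
Proof.
move=> aW; split=> // a' q' a'W; rewrite nsetE.
by case: eqP => [e|//]; rewrite e aW in a'W.
Qed.

Lemma run_agree p s : agree (nwrites p) (rwrites p) s (run p s).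
Proof.
elim: p s => /= [|a e v|a e v|p1 h1 p2 h2|b p1 h1 p2 h2|x e q h] s.
- by split.
- by apply: agree_nset; rewrite inE.
- split=> // a' q' a'W; rewrite rsetE.
  by case: eqP => [ea|//]; rewrite ea inE eqxx in a'W.
- apply: (@agree_trans _ _ _ (run p1 s)).
    by apply: agree_sub (h1 s) => z; rewrite mem_cat => ->.
  by apply: agree_sub (h2 _) => z; rewrite mem_cat orbC => ->.
- case: ifP => _.
    by apply: agree_sub (h1 s) => z; rewrite mem_cat => ->.
  by apply: agree_sub (h2 _) => z; rewrite mem_cat orbC => ->.
- elim: (neval s e) => [|j ih] /=; first by apply: agree_nset; rewrite inE eqxx.
  apply: (agree_trans ih); set s1 := iter _ _ _.
  apply: (@agree_trans _ _ _ (run q s1)).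
    by apply: agree_sub (h _) => // z; rewrite inE orbC => ->.
  by apply: agree_nset; rewrite inE eqxx.
Qed.

Lemma run_nframe p s a q : a \notin nwrites p ->
  nmem (run p s) a q = nmem s a q.
Proof. by case: (run_agree p s) => h _; apply: h. Qed.

Lemma run_rframe p s a q : a \notin rwrites p ->
  rmem (run p s) a q = rmem s a q.
Proof. by case: (run_agree p s) => _ h; apply: h. Qed.

(** The step receives the frame [agree] and the value of the counter for free, so that an invariant
    need only speak of what the loop changes. *)
Lemma for_rule (I : nat -> state R -> Prop) x e q s N :
  neval s e = N -> x \notin nwrites q ->
  I 0%N (nset s x 0 0) ->
  (forall i s1, (i < N)%N -> agree (x :: nwrites q) (rwrites q) s s1 ->
     nmem s1 x 0 = i -> I i s1 -> I i.+1 (nset (run q s1) x 0 i.+1)) ->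
  I N (run (PFor x e q) s).
Proof.
move=> <- xq I0 IS /=; set f := fun s1 => _; set s0 := nset _ _ _ _.
have : forall i, (i <= neval s e)%N ->
  [/\ agree (x :: nwrites q) (rwrites q) s (iter i f s0),
      nmem (iter i f s0) x 0 = i & I i (iter i f s0)].
  elim=> [|i ih] ilt.
    by split=> //; [apply: agree_nset; rewrite inE eqxx|rewrite nsetE !eqxx].
  case: (ih (ltnW ilt)) => ag xi Ii.
  have fE : f (iter i f s0) = nset (run q (iter i f s0)) x 0 i.+1.
    by rewrite /f run_nframe // xi addn1.
  split; rewrite iterS fE.
  - apply: (agree_trans ag).
    apply: (@agree_trans _ _ _ (run q (iter i f s0))).
      by apply: agree_sub (run_agree _ _) => // z; rewrite inE orbC => ->.
    by apply: agree_nset; rewrite inE eqxx.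
  - by rewrite nsetE !eqxx.
  - exact: IS.
by move=> /(_ _ (leqnn _)) [].
Qed.

Lemma neval_agree0 s s1 e : all (pred1 0%N) (nreads e) ->
  (forall q, nmem s1 0 q = nmem s 0 q) -> neval s1 e = neval s e.
Proof.
move=> he h; elim: e he => //= [a e ih /andP[/eqP-> /ih->]|e1 h1 e2 h2|e1 h1 e2 h2].
- exact: h.
- by rewrite all_cat => /andP[/h1-> /h2->].
- by rewrite all_cat => /andP[/h1-> /h2->].
Qed.

Lemma well_formed_nwrites0 p : well_formed p -> 0%N \notin nwrites p.
Proof.
elim: p => //= [a _ _|p1 h1 p2 h2|_ p1 h1 p2 h2|x e q h].
- by rewrite inE eq_sym.
- by case/andP=> /h1 a1 /h2 a2; rewrite mem_cat negb_or a1.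
- by case/andP=> /h1 a1 /h2 a2; rewrite mem_cat negb_or a1.
- by case/and4P=> /h a1 x0 _ _; rewrite inE negb_or eq_sym x0.
Qed.

Lemma well_formed_bounds p :
  well_formed p -> all (fun e => all (pred1 0%N) (nreads e)) (loop_bounds p).
Proof.
elim: p => //= [p1 h1 p2 h2|_ p1 h1 p2 h2|x e q h].
- by case/andP=> /h1 a1 /h2 a2; rewrite all_cat a1.
- by case/andP=> /h1 a1 /h2 a2; rewrite all_cat a1.
- by case/and4P=> /h -> _ _ ->.
Qed.

Definition bounded M p s := all (fun e => neval s e <= M)%N (loop_bounds p).

Lemma bounded_agree0 M p s s1 : well_formed p ->
  (forall q, nmem s1 0 q = nmem s 0 q) -> bounded M p s -> bounded M p s1.
Proof.
move=> /well_formed_bounds + h; rewrite /bounded.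
elim: (loop_bounds p) => //= e l ih /andP[e0 /ih{}ih] /andP[eM /ih->].
by rewrite (neval_agree0 e0 h) eM.
Qed.

Lemma exec_compile M p s : well_formed p -> bounded M p s ->
  exists2 t, (t <= cost M p)%N & exec (compile p) s t (run p s).
Proof.
elim: p s => /= [|a e v|a e v|p1 h1 p2 h2|b p1 h1 p2 h2|x e q h] s.
- by exists 1%N => //; constructor.
- by exists 1%N => //; constructor.
- by exists 1%N => //; constructor.
- case/andP=> w1 w2; rewrite /bounded /= all_cat => /andP[b1 b2].
  have [t1 l1 e1] := h1 s w1 b1.
  have [|t2 l2 e2] := h2 (run p1 s) w2.
    apply: bounded_agree0 b2 => // q'.
    by rewrite run_nframe // well_formed_nwrites0.
  by exists (t1 + t2)%N; [exact: leq_add|apply: ExecSeq e1 e2].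
- case/andP=> w1 w2; rewrite /bounded /= all_cat => /andP[b1 b2].
  case: ifP => bs.
    have [t1 l1 e1] := h1 s w1 b1.
    by exists t1.+1; [lia|apply: ExecIfTrue].
  have [t1 l1 e1] := h2 s w2 b2.
  by exists t1.+1; [lia|apply: ExecIfFalse => //; rewrite bs].
- case/and4P=> wq x0 xq e0; rewrite /bounded /= => /andP[eM bq].
  set f := (f in iter _ f _); rewrite eq_sym in x0.
  have w0 := well_formed_nwrites0 wq.
  have f0 s1 a : nmem (f s1) 0 a = nmem s1 0 a.
    by rewrite nsetE (negbTE x0) /= run_nframe.
  (* Induction on the number [j] of remaining rounds, over all states that agree with [s] on array
     0, where the bound keeps its value. *)
  have loop j s1 : (nmem s1 x 0 + j = neval s e)%N ->
      (forall a, nmem s1 0 a = nmem s 0 a) ->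
      exists2 t, (t <= (j * (cost M q).+2).+1)%N &
        exec (While (BNot (NLe e (var x)))
          (Seq (compile q) (NSet x (NConst 0) (NAdd (var x) (NConst 1)))))
          s1 t (iter j f s1).
    elim: j s1 => [|j ih] s1 xj s10.
      exists 1%N => //; apply: ExecWhileFalse => /=.
      by rewrite negbK (neval_agree0 e0 s10); lia.
    have [||t lt et] := ih (f s1).
    - rewrite /f nsetE !eqxx /= run_nframe //; lia.
    - by move=> a; rewrite f0.
    have [|t1 l1 e1] := h s1 wq; first exact: bounded_agree0 bq.
    exists (t1 + 1 + t).+1; first by rewrite mulSn; lia.
    rewrite iterSr; apply: ExecWhileTrue et.
      by rewrite /= (neval_agree0 e0 s10); lia.
    by apply: ExecSeq e1 _; apply: ExecNSet.
  have [||t lt et] := loop (neval s e) (nset s x 0 0).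
  - by rewrite nsetE !eqxx.
  - by move=> a; rewrite nsetE (negbTE x0).
  exists (1 + t)%N; last by apply: ExecSeq et; apply: ExecNSet.
  apply: (@leq_trans (neval s e * (cost M q).+2).+2); first by lia.
  by rewrite !ltnS leq_mul2r eM orbT.
Qed.

End Semantics.

Arguments nset : simpl never.
Arguments rset : simpl never.
Arguments run : simpl never.
Arguments nmem : simpl never.
Arguments rmem : simpl never.

(** * Elimination over the two-element field *)

Lemma F2P (x : 'F_2) : x = 0 \/ x = 1.
Proof. by case: x => [[|[|x]] hx] //; [left|right]; apply: val_inj. Qed.

Lemma F2_addxx (x : 'F_2) : x + x = 0.
Proof. by case: (F2P x) => ->; apply: val_inj. Qed.

Lemma F2_addr_eq0 (x y : 'F_2) : (x + y == 0) = (x == y).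
Proof. by case: (F2P x) => ->; case: (F2P y) => ->. Qed.

(** The right-hand side is the expression [NXor] of the machine: under truncated subtraction at
    least one of the two terms vanishes. *)
Lemma F2_val_add (x y : 'F_2) :
  nat_of_ord (x + y) = ((x : nat) - y + ((y : nat) - x))%N.
Proof. by case: (F2P x) => ->; case: (F2P y) => ->. Qed.

Lemma F2_mx_addxx (p q : nat) (M : 'M['F_2]_(p, q)) : M + M = 0.
Proof. by apply/matrixP => i j; rewrite !mxE F2_addxx. Qed.

Lemma F2_mx_addr_eq0 (p q : nat) (M N : 'M['F_2]_(p, q)) :
  (M + N == 0) = (M == N).
Proof.
apply/eqP/eqP => [|->]; last exact: F2_mx_addxx.
by move=> h; rewrite -[M]addr0 -(F2_mx_addxx N) addrA h add0r.
Qed.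

Section Elimination.
Variable n : nat.
Implicit Types (X Y : nat -> 'rV['F_2]_n) (L G : seq nat) (v : 'rV['F_2]_n).

Definition rspan X L := <<[seq X l | l <- L]>>%VS.

Lemma mem_rspan_cons X a L v :
  (v \in rspan X (a :: L)) = (v \in rspan X L) || (v + X a \in rspan X L).
Proof.
rewrite /rspan /= span_cons; apply/memv_addP/orP.
  case=> u1 /vlineP[e ->] [u2 u2L ->]; case: (F2P e) => ->.
    by left; rewrite scale0r add0r.
  by right; rewrite scale1r addrAC F2_mx_addxx add0r.
case=> h; first by exists 0; rewrite ?mem0v //; exists v; rewrite ?add0r.
exists (X a); first by apply: memv_line.
by exists (v + X a) => //; rewrite addrC -addrA F2_mx_addxx addr0.
Qed.

(** [X] represents the rows of [X0] modulo the span of those listed in [L]. The matrix [T] acts as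
    the quotient map but remains square, so that all rows keep the same type. *)
Definition reach X0 L X := exists T : 'M['F_2]_n,
  (forall i, X i = X0 i *m T) /\
  (forall v, (v *m T == 0) = (v \in rspan X0 L)).

Lemma reach_nil X : reach X [::] X.
Proof.
exists 1%:M; split=> [i|v]; first by rewrite mulmx1.
by rewrite mulmx1 /rspan /= span_nil memv0.
Qed.

Lemma reach_eq0 X0 L X i : reach X0 L X -> (X i == 0) = (X0 i \in rspan X0 L).
Proof. by case=> T [XE kerE]; rewrite XE kerE. Qed.

Lemma reach_eq X0 L X i j :
  reach X0 L X -> (X i == X j) = (X0 i + X0 j \in rspan X0 L).
Proof. by case=> T [XE kerE]; rewrite -kerE mulmxDl -!XE F2_mx_addr_eq0. Qed.

(** The effect on the coefficients of solving equation [a] for the variable [p]. When [X a] has a 1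
    in column [p], this linear map has kernel {0, [X a]}. *)
Definition elim_rows X a (p : 'I_n) : nat -> 'rV['F_2]_n :=
  fun i => X i + X i 0 p *: X a.

Lemma elim_vec_eq0 (r v : 'rV['F_2]_n) (p : 'I_n) :
  r 0 p = 1 -> (v + v 0 p *: r == 0) = (v == 0) || (v == r).
Proof.
move=> rp; rewrite F2_mx_addr_eq0; apply/eqP/orP => [h|[]/eqP->].
- by rewrite h; case: (F2P (v 0 p)) => ->; rewrite ?scale0r ?scale1r eqxx;
    [left|right].
- by rewrite mxE scale0r.
- by rewrite rp scale1r.
Qed.

Lemma elim_mulmx (r v : 'rV['F_2]_n) (p : 'I_n) :
  v *m (1%:M + delta_mx p 0 *m r) = v + v 0 p *: r.
Proof.
rewrite mulmxDr mulmx1 mulmxA -colE; congr (_ + _).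
apply/rowP => j; rewrite !mxE big_ord1 !mxE; congr (v _ _ * _).
Qed.

Lemma reach_elim X0 L X a p : X a 0 p = 1 ->
  reach X0 L X -> reach X0 (a :: L) (elim_rows X a p).
Proof.
move=> ap [T [XE kerE]]; exists (T *m (1%:M + delta_mx p 0 *m X a)).
split=> [i|v]; first by rewrite mulmxA -XE elim_mulmx.
rewrite mulmxA elim_mulmx elim_vec_eq0 // kerE mem_rspan_cons; congr (_ || _).
by rewrite -kerE mulmxDl -XE F2_mx_addr_eq0.
Qed.

Lemma rspan_mulmx X Y (T : 'M['F_2]_n) L v : (forall i, Y i = X i *m T) ->
  v \in rspan X L -> v *m T \in rspan Y L.
Proof.
move=> YE; elim: L v => [|b L ih] u.
  by rewrite /rspan /= span_nil !memv0 => /eqP->; rewrite mul0mx.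
rewrite !mem_rspan_cons => /orP[/ih->//|/ih].
by rewrite mulmxDl YE => ->; rewrite orbT.
Qed.

Lemma mem_rspan_mulmx X Y (T : 'M['F_2]_n) L G v :
  (forall i, Y i = X i *m T) ->
  (forall u, (u *m T == 0) = (u \in rspan X G)) ->
  (v *m T \in rspan Y L) = (v \in rspan X (L ++ G)).
Proof.
move=> YE kerE; elim: L v => [|a L ih] v /=.
  by rewrite /rspan /= span_nil memv0 kerE.
by rewrite !mem_rspan_cons ih YE -mulmxDl ih.
Qed.

Lemma reach_trans X0 G Y L X :
  reach X0 G Y -> reach Y L X -> reach X0 (L ++ G) X.
Proof.
case=> T [YE kT] [U [XE kU]]; exists (T *m U); split=> [i|v].
  by rewrite mulmxA -YE.
by rewrite mulmxA kU (mem_rspan_mulmx _ _ YE kT).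
Qed.

(** * Greedy lists, sum-free lists and the halving of classes *)

Variable m : nat.

(* [L] lists the chosen rows, the last chosen one first. *)
Fixpoint greedy Y L : Prop :=
  if L is a :: L' then
    [/\ greedy Y L', (a < m)%N, Y a \notin rspan Y L'
      & forall b, (b < m)%N -> Y b + Y a \in rspan Y L' -> Y b = Y a]
  else True.

Definition stuck Y L a :=
  Y a \in rspan Y L \/
  exists b, [/\ (b < m)%N, Y b + Y a \in rspan Y L & Y b <> Y a].

(** A rejected row stays rejected while the list grows; this is why one scan per round suffices. *)
Lemma stuck_cons Y L a b : stuck Y L a -> stuck Y (b :: L) a.
Proof.
case=> [h|[c [cm h1 h2]]]; first by left; rewrite mem_rspan_cons h.
by right; exists c; split; rewrite // mem_rspan_cons h1.
Qed.

Lemma mem_greedy Y L a : greedy Y L -> a \in L -> (a < m)%N.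
Proof.
elim: L => //= b L ih [gL bm _ _]; rewrite inE => /orP[/eqP->//|].
exact: ih.
Qed.

(** [T] is injective on this span because it maps the listed rows to independent ones: a combination
    killed by [T] whose last chosen row is [a] would put [Y a] in the span of the rows chosen
    before. *)
Lemma greedy_free X Y (T : 'M['F_2]_n) L v : (forall i, Y i = X i *m T) ->
  greedy Y L -> v \in rspan X L -> v *m T = 0 -> v = 0.
Proof.
move=> YE; elim: L v => [|a L ih] v /=.
  by rewrite /rspan /= span_nil memv0 => _ /eqP.
case=> gL _ aL _; rewrite mem_rspan_cons => /orP[|vL v0]; first exact: ih.
case/negP: aL; rewrite YE -[X a]add0r -(F2_mx_addxx v) -addrA mulmxDl v0 add0r.
exact: rspan_mulmx vL.
Qed.

(** If a sum of two or more listed rows were a row, the last clause, taken at the last chosen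
    summand [a], would identify this row with [X a], against independence. *)
Fixpoint sum_free X L : Prop :=
  if L is a :: L' then
    [/\ sum_free X L', X a \notin rspan X L'
      & forall b, (b < m)%N -> X b + X a \in rspan X L' -> b = a]
  else True.

(** A relation between rows of [X] maps to one between rows of [Y], where greediness makes the two
    rows equal; [greedy_free] lifts the equality back to [X]. *)
Lemma greedy_sum_free X Y (T : 'M['F_2]_n) L : (forall i, Y i = X i *m T) ->
  (forall i j, (i < m)%N -> (j < m)%N -> X i = X j -> i = j) ->
  greedy Y L -> sum_free X L.
Proof.
move=> YE Xinj; elim: L => //= a L ih [gL am aL aU]; split; first exact: ih.
  by apply: contra aL => /(rspan_mulmx YE); rewrite -YE.
move=> b bm h; apply: Xinj => //; apply/eqP; rewrite -F2_mx_addr_eq0; apply/eqP.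
apply: (greedy_free YE gL h); apply/eqP.
rewrite mulmxDl -!YE F2_mx_addr_eq0; apply/eqP/aU => //.
by rewrite !YE -mulmxDl; apply: rspan_mulmx h.
Qed.

Lemma sum_free_drop X L i : sum_free X L -> sum_free X (drop i L).
Proof. by elim: L i => [|a L ih] [|i] //= [sL _ _]; apply: ih. Qed.

(** Zero always counts as a class, so the number of classes is positive; it is at most [m + 1]. *)
Definition classes X : {set 'rV['F_2]_n} := 0 |: [set X (val i) | i : 'I_m].

Lemma mem_classes X i : (i < m)%N -> X i \in classes X.
Proof.
by move=> im; rewrite inE; apply/orP; right; apply/imsetP; exists (Ordinal im).
Qed.

(** The quotient map sends the classes of [Y] into those of [X], and every fibre has at least two
    elements. *)
Lemma classes_halve Y L X : reach Y L X -> L <> [::] -> greedy Y L ->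
  (forall a, (a < m)%N -> stuck Y L a) -> (2 * #|classes X| <= #|classes Y|)%N.
Proof.
move=> rL L0 gL st; have [T [XE kerE]] := rL.
have sub : [set v *m T | v in classes Y] \subset classes X.
  apply/fintype.subsetP => _ /imsetP[v + ->];
    rewrite inE => /orP[|/imsetP[i _ ->]].
    by rewrite inE => /eqP->; rewrite mul0mx setU11.
  by rewrite -XE mem_classes // (valP i).
have -> : #|classes Y| =
    (\sum_(x in classes X) #|[set v in classes Y | v *m T == x]|)%N.
  rewrite -sum1_card (partition_big (fun v => v *m T) (mem (classes X))) /=.
    apply: eq_bigr => x _; rewrite -sum1_card; apply: eq_bigl => v.
    by rewrite inE.
  by move=> v vY; apply: (fintype.subsetP sub); apply: imset_f.
rewrite mulnC -sum_nat_const; apply: leq_sum => x xX.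
suff [u [v [uY vY uv uT vT]]] : exists u v,
    [/\ u \in classes Y, v \in classes Y, u != v, u *m T = x & v *m T = x].
  have uv2 : #|[set u; v]| = 2%N by rewrite cards2 uv.
  apply: leq_trans (_ : #|[set u; v]| <= _)%N; first by rewrite uv2.
  apply: subset_leq_card; apply/fintype.subsetP => z.
  by rewrite in_set2 => /orP[]/eqP->;
    rewrite finset.in_set ?uT ?vT eqxx ?uY ?vY.
(* The fibre of zero contains 0 and the last picked row. *)
have [->|x0] := eqVneq x 0.
  case: L L0 gL rL {st kerE} => // l L _ /= [_ lm lL _] rL.
  exists (Y l), 0; split; rewrite ?mem_classes ?setU11 ?mul0mx //.
    by apply: contra lL => /eqP->; rewrite mem0v.
  rewrite -XE; apply/eqP; rewrite (reach_eq0 _ rL) mem_rspan_cons F2_mx_addxx.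
  by rewrite mem0v orbT.
(* A nonzero class comes from a row [a] outside the span, so being stuck provides a second element
   of the fibre. *)
move: xX; rewrite inE inE (negbTE x0) /= => /imsetP[[a am] _ /= xE].
case: (st a am) => [|[b [bm bL /eqP ba]]].
  by rewrite -(reach_eq0 _ rL) -xE (negbTE x0).
exists (Y a), (Y b); split; rewrite ?mem_classes ?[Y a == _]eq_sym // -XE //.
by rewrite xE; apply/eqP; rewrite (reach_eq _ _ rL).
Qed.

(** * The number of rounds of the search *)

Section Search.
Variables (A : nat -> 'rV['F_2]_n) (k : nat).
Hypothesis A_full : forall U : {vspace 'rV['F_2]_n},
  (forall i, (i < m)%N -> A i \in U) -> (n <= \dim U)%N.
Hypotheses (k_ge2 : (2 <= k)%N) (m_small : (m.+2 ^ k.-1 <= 2 ^ n)%N).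

(* The state of the search after [s] unsuccessful rounds. *)
Definition search_inv (s : nat) Y := exists G,
  [/\ (size G <= k.-1 * s)%N, reach A G Y & (2 ^ s * #|classes Y| <= m.+1)%N].

Lemma classes_gt0 X : (0 < #|classes X|)%N.
Proof. by apply/card_gt0P; exists 0; rewrite setU11. Qed.

Lemma search_inv0 : search_inv 0 A.
Proof.
exists [::]; split=> //; first exact: reach_nil.
rewrite mul1n; apply: leq_trans (leq_card_setU _ _).1 _;
  rewrite cards1 add1n ltnS.
by apply: leq_trans (leq_imset_card _ _) _; rewrite card_ord.
Qed.

(** Otherwise (m+2)^(k-1) <= 2^n <= (2^s)^(k-1) <= (m+1)^(k-1). *)
Lemma search_inv_small s Y : search_inv s Y -> (k.-1 * s < n)%N.
Proof.
case=> G [_ _ cl]; have c0 := classes_gt0 Y; rewrite ltnNge; apply/negP => ns.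
have sm : (2 ^ s <= m.+1)%N by apply: leq_trans cl; rewrite leq_pmulr.
have : (m.+2 ^ k.-1 <= m.+1 ^ k.-1)%N.
  apply: leq_trans m_small _; apply: (@leq_trans (2 ^ (k.-1 * s))).
    by rewrite leq_exp2l.
  by rewrite mulnC expnM leq_exp2r //; lia.
by rewrite leq_exp2r ?ltnn //; lia.
Qed.

(** As k - 1 >= 1, this caps the search at [n] rounds. *)
Lemma search_inv_n Y : ~ search_inv n Y.
Proof. by move/search_inv_small; nia. Qed.

Lemma search_step s Y L X : search_inv s Y -> reach Y L X -> greedy Y L ->
  (size L < k)%N -> (forall a, (a < m)%N -> stuck Y L a) -> search_inv s.+1 X.
Proof.
move=> iY rL gL Lk st; have sn := search_inv_small iY.
case: iY => G [sG rG cl].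
(* If nothing is picked, all rows of [Y] are zero, so those of [A] lie in the span of [G], of
   dimension at most (k-1)s < n. *)
have L0 : L <> [::].
  move=> L0; rewrite L0 in st; have AG i : (i < m)%N -> A i \in rspan A G.
    move=> im; rewrite -(reach_eq0 _ rG).
    case: (st i im); first by rewrite /rspan /= span_nil memv0.
    case=> b [_ + ne]; rewrite /rspan /= span_nil memv0 F2_mx_addr_eq0.
    by move/eqP/ne.
  have := leq_trans (A_full AG) (dim_span _); rewrite size_map => nG.
  by have := leq_ltn_trans (leq_trans nG sG) sn; rewrite ltnn.
exists (L ++ G); split; first by rewrite size_cat mulnS leq_add //; lia.
  exact: reach_trans rG rL.
apply: leq_trans cl; rewrite expnSr -mulnA leq_mul2l.
by rewrite (classes_halve rL) ?orbT.
Qed.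

End Search.

(** * The excess secured by eliminations *)

Section Potential.
Variables (R : realType) (W : nat -> R).
Implicit Type c : nat -> 'F_2.

Definition signed (b : 'F_2) (x : R) := if b == 0 then x else - x.

(** The excess of the equations already decided: a zero row no longer depends on the variables, and
    holds exactly when its right-hand side is 0. *)
Definition potential X c := \sum_(i < m | X i == 0) signed (c i) (W i).

(** The excess, when equation [a] is satisfied, of the equations that are decided together with
    it. *)
Definition gain X c a := \sum_(i < m | X i == X a) signed (c i + c a) (W i).

Definition elim_bit X c a := if 0 <= gain X c a then c a else c a + 1.

Definition elim_rhs X c a (p : 'I_n) : nat -> 'F_2 :=
  fun i => c i + X i 0 p * elim_bit X c a.

(** The rows that become zero are those equal to [X a]. They contribute the gain, or its opposite if
    the bit is flipped, which happens exactly when the gain is negative. *)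
Lemma potential_elim X c a p : X a 0 p = 1 ->
  potential (elim_rows X a p) (elim_rhs X c a p) =
  potential X c + `|gain X c a|.
Proof.
move=> ap; rewrite /potential.
rewrite (eq_bigl (fun i : 'I_m => (X i == 0) || (X i == X a))); last first.
  by move=> i; rewrite /elim_rows elim_vec_eq0.
have a0 : X a != 0.
  by apply/eqP => h; move: ap; rewrite h mxE => /eqP; rewrite eq_sym oner_eq0.
rewrite (bigID (fun i : 'I_m => X i == 0)) /=; congr (_ + _).
  apply: eq_big => [i|i]; first by rewrite andbC; case: eqP.
  by case/andP=> _ /eqP i0; rewrite /elim_rhs i0 mxE mul0r addr0.
rewrite (eq_bigl (fun i : 'I_m => X i == X a)); last first.
  move=> i; case: eqP => [->|_]; rewrite ?andbT //=.
  by rewrite eq_sym (negbTE a0).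
have E i : X i == X a -> elim_rhs X c a p i = c i + elim_bit X c a.
  by move=> /eqP h; rewrite /elim_rhs h ap mul1r.
case: (ger0P (gain X c a)) => g.
  apply: eq_bigr => i /E ->; by rewrite /elim_bit g.
rewrite /gain -sumrN; apply: eq_bigr => i /E ->; rewrite /elim_bit leNgt g /=.
rewrite /signed; case: (F2P (c i)) => ->; case: (F2P (c a)) => -> /=;
  by rewrite ?opprK.
Qed.

Definition elim_step X c a X' c' :=
  (X a = 0 /\ X' = X /\ c' = c) \/
  exists p, [/\ X a 0 p = 1, X' = elim_rows X a p & c' = elim_rhs X c a p].

Lemma elim_step_potential X c a X' c' :
  elim_step X c a X' c' -> potential X c <= potential X' c'.
Proof.
case=> [[_ [-> ->]]//|[p [ap -> ->]]].
by rewrite potential_elim // lerDl.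
Qed.

Lemma elim_step_self X c a X' c' : elim_step X c a X' c' -> X' a = 0.
Proof.
case=> [[a0 [-> _]]//|[p [ap -> _]]].
by rewrite /elim_rows ap scale1r F2_mx_addxx.
Qed.

Lemma elim_step_zero X c a X' c' i :
  elim_step X c a X' c' -> X i = 0 -> X' i = 0.
Proof.
case=> [[_ [-> _]]//|[p [_ -> _]]] i0.
by rewrite /elim_rows i0 mxE scale0r addr0.
Qed.

Lemma elim_step_reach X0 L X c a X' c' : X a != 0 ->
  elim_step X c a X' c' -> reach X0 L X -> reach X0 (a :: L) X'.
Proof.
move=> a0; case=> [[h _]|[p [ap -> _]] r]; first by rewrite h eqxx in a0.
exact: reach_elim.
Qed.

(** By sum-freeness [a] is the only row equal to [X a], so the gain is its own weight. *)
Lemma elim_step_sum_free X0 L X c a X' c' : (forall i, (i < m)%N -> 0 <= W i) ->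
  (a < m)%N -> sum_free X0 (a :: L) -> reach X0 L X -> elim_step X c a X' c' ->
  reach X0 (a :: L) X' /\ potential X' c' = potential X c + W a.
Proof.
move=> W0 am [_ aL aU] r st.
have a0 : X a != 0 by rewrite (reach_eq0 _ r).
split; first exact: elim_step_reach st r.
case: st => [[h _]|[p [ap -> ->]]]; first by rewrite h eqxx in a0.
rewrite potential_elim //; congr (_ + _).
rewrite /gain (big_pred1 (Ordinal am)) /=.
  by rewrite F2_addxx /signed eqxx ger0_norm ?W0.
move=> i; rewrite (reach_eq _ _ r); apply/idP/eqP => [h|->].
  by apply: val_inj => /=; apply: aU.
by rewrite F2_mx_addxx mem0v.
Qed.

(* The current system is the initial one after the affine change of variables
   [z = T z' + y]. *)
Definition affine_inv X0 (c0 : nat -> 'F_2) X c y := exists T : 'M['F_2]_n,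
  (forall i, X i = X0 i *m T) /\
  (forall i, c i = c0 i + (X0 i *m y) 0 (0 : 'I_1)).

Lemma affine_inv0 X0 c0 : affine_inv X0 c0 X0 c0 0.
Proof.
by exists 1%:M; split=> i; rewrite ?mulmx1 // mulmx0 mxE addr0.
Qed.

Lemma elim_step_affine X0 c0 X c y a X' c' :
  elim_step X c a X' c' -> affine_inv X0 c0 X c y ->
  exists y', affine_inv X0 c0 X' c' y'.
Proof.
case=> [[_ [-> ->]] h|[p [ap -> ->]] [T [XE cE]]]; first by exists y.
(* With r the row [X a], the substitution z' = (1 + e_p r) z'' + bit e_p enforces r z' = bit;
   composed with z = T z' + y, it adds bit times column [p] of [T] to [y]. *)
exists (y + elim_bit X c a *: col p T).
exists (T *m (1%:M + delta_mx p 0 *m X a)); split=> i.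
  by rewrite mulmxA -XE elim_mulmx.
rewrite /elim_rhs mulmxDr mxE cE -addrA; congr (_ + (_ + _)).
by rewrite -scalemxAr mxE XE mulrC colE mulmxA -colE [col _ _ _ _]mxE.
Qed.

End Potential.
End Elimination.

(** * The algorithm *)

(* Arrays of the algorithm.  [aOFFSET] holds the multiples of [n], since the
   machine cannot multiply; [aMAT] and [aRHS] hold the system after the
   eliminations made so far; [aOLD] holds the rows of [aMAT] at the start of the
   current round; [aLIST] holds the [aLEN] rows picked so far, the first picked
   one first; [aROW], [aPIV] and [aBIT] hold the row, the variable and the
   right-hand side used by the current elimination; [aEQM], [aEQO] and [aELIG]
   hold truth values; the others are loop variables. *)
Local Notation aOFFSET := 4%N (only parsing).
Local Notation aMAT := 5%N (only parsing).
Local Notation aRHS := 6%N (only parsing).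
Local Notation aOLD := 7%N (only parsing).
Local Notation aLIST := 8%N (only parsing).
Local Notation aLEN := 9%N (only parsing).
Local Notation aROW := 10%N (only parsing).
Local Notation aPIV := 11%N (only parsing).
Local Notation aBIT := 12%N (only parsing).
Local Notation aI := 13%N (only parsing).
Local Notation aJ := 14%N (only parsing).
Local Notation aB := 15%N (only parsing).
Local Notation aA := 16%N (only parsing).
Local Notation aT := 17%N (only parsing).
Local Notation aEQM := 18%N (only parsing).
Local Notation aEQO := 19%N (only parsing).
Local Notation aELIG := 20%N (only parsing).
Local Notation aQ := 21%N (only parsing).

Definition Vn := NGet 0 (NConst 0).
Definition Vm := NGet 0 (NConst 1).
Definition Vk := NGet 0 (NConst 2).
Definition Vmn := NAdd Vm Vn.
Definition cell i j := NAdd (NGet aOFFSET i) j.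
Definition NEq e1 e2 := BAnd (NLe e1 e2) (NLe e2 e1).
Definition NLt e1 e2 := BNot (NLe e2 e1).
Definition NXor e1 e2 := NAdd (NSub e1 e2) (NSub e2 e1).
Local Notation pset x e := (PN x (NConst 0) e).
Local Notation "p ;; q" := (PSeq p q) (at level 61, right associativity).

Definition offset_prog :=
  PFor aI Vmn (PN aOFFSET (NAdd (var aI) (NConst 1)) (NAdd (NGet aOFFSET (var aI)) Vn)).

Definition fill_row_prog dst v :=
  PFor aJ Vn (PN dst (cell (var aI) (var aJ)) v).

Definition copy_prog src dst e :=
  PFor aI e (fill_row_prog dst (NGet src (cell (var aI) (var aJ)))).

(** The input reads as 0 beyond row [m], so copying [m + n] rows appends zero rows, in which the
    last loop writes unit vectors. *)
Definition init_prog :=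
  PFor aI Vmn (PN aRHS (var aI) (NGet 2 (var aI))) ;;
  copy_prog 1 aMAT Vmn ;;
  PFor aJ Vn (PN aMAT (cell (NAdd Vm (var aJ)) (var aJ)) (NConst 1)).

(** The default value [n] signals a zero row. *)
Definition pivot_prog :=
  pset aPIV Vn ;;
  PFor aJ Vn
    (PIf (NLe (NConst 1) (NGet aMAT (cell (var aA) (var aJ))))
       (pset aPIV (var aJ)) PSkip).

Definition eqrow_prog src dst :=
  pset dst (NConst 1) ;;
  PFor aJ Vn
    (PIf (NEq (NGet src (cell (var aA) (var aJ)))
              (NGet src (cell (var aB) (var aJ))))
       PSkip (pset dst (NConst 0))).

(** A copy is required because [addrow_prog] turns the row itself into 0 while later rows still have
    to be reduced by it. *)
Definition saverow_prog :=
  PFor aJ Vn (PN aROW (var aJ) (NGet aMAT (cell (var aA) (var aJ)))).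

Definition rvar := RGet 1 (NConst 0).

(** The machine has no real constants; [RSub rvar rvar] produces 0. *)
Definition gain_prog :=
  PR 1 (NConst 0) (RSub rvar rvar) ;;
  PFor aB Vm
    (eqrow_prog aMAT aEQM ;;
     PIf (NLe (NConst 1) (var aEQM))
       (PIf (NEq (NGet aRHS (var aB)) (NGet aRHS (var aA)))
          (PR 1 (NConst 0) (RAdd rvar (RGet 0 (var aB))))
          (PR 1 (NConst 0) (RSub rvar (RGet 0 (var aB)))))
       PSkip).

Definition bit_prog :=
  PIf (RLe (RSub rvar rvar) rvar) (pset aBIT (NGet aRHS (var aA)))
    (pset aBIT (NSub (NConst 1) (NGet aRHS (var aA)))).

Definition addrow_prog :=
  PFor aI Vmn
    (PIf (NLe (NConst 1) (NGet aMAT (cell (var aI) (var aPIV))))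
       (PN aRHS (var aI) (NXor (NGet aRHS (var aI)) (var aBIT)) ;;
        fill_row_prog aMAT (NXor (NGet aMAT (cell (var aI) (var aJ))) (NGet aROW (var aJ))))
       PSkip).

Definition elim_prog :=
  pivot_prog ;;
  PIf (NLt (var aPIV) Vn)
    (saverow_prog ;; gain_prog ;; bit_prog ;; addrow_prog) PSkip.

Definition eligible_prog :=
  pivot_prog ;;
  PIf (NLt (var aPIV) Vn) (pset aELIG (NConst 1)) (pset aELIG (NConst 0)) ;;
  PFor aB Vm
    (eqrow_prog aMAT aEQM ;; eqrow_prog aOLD aEQO ;;
     PIf (BAnd (NLe (NConst 1) (var aEQM)) (NLe (var aEQO) (NConst 0)))
       (pset aELIG (NConst 0)) PSkip).

(** A picked row is eliminated at once, so that [aMAT] always shows the rows modulo [D], while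
    [aOLD] shows them modulo [U]. *)
Definition round_prog :=
  pset aLEN (NConst 0) ;;
  copy_prog aMAT aOLD Vm ;;
  PFor aA Vm
    (PIf (NLt (var aLEN) Vk)
       (eligible_prog ;;
        PIf (NLe (NConst 1) (var aELIG))
          (PN aLIST (var aLEN) (var aA) ;;
           pset aLEN (NAdd (var aLEN) (NConst 1)) ;;
           elim_prog)
          PSkip)
       PSkip).

Definition search_prog := PFor aT Vn (PIf (NLt (var aLEN) Vk) round_prog PSkip).

Definition satisfy_prog :=
  PFor aQ Vk (pset aA (NGet aLIST (var aQ)) ;; elim_prog).

Definition finish_prog := PFor aA Vm elim_prog.

Definition output_prog :=
  PFor aJ Vn (PN 3 (var aJ) (NGet aRHS (NAdd Vm (var aJ)))).

(** The search delivers the list [aLIST]; the second [init_prog] then restores the input system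
    before the listed rows are eliminated in order. *)
Definition main_prog :=
  offset_prog ;; init_prog ;; search_prog ;;
  init_prog ;; satisfy_prog ;; finish_prog ;; output_prog.

Lemma main_prog_wf : well_formed main_prog.
Proof. by []. Qed.

Lemma cell_eq n i j i' j' : (j < n)%N -> (j' < n)%N ->
  (i * n + j == i' * n + j')%N = (i == i') && (j == j').
Proof.
move=> jn jn'; apply/eqP/andP => [h|[/eqP-> /eqP->]//].
have n0 : (0 < n)%N by lia.
have := congr1 (divn^~ n) h; have := congr1 (modn^~ n) h.
rewrite !modnMDl !modn_small // => ->;
  rewrite !divnMDl // !divn_small // !addn0.
by move=> ->.
Qed.

(** * Correctness of the subprograms *)

Section Specs.
Variables (R : realType) (n m k : nat).
Variables (A1 : nat -> 'rV['F_2]_n) (c0 : nat -> 'F_2) (W : nat -> R).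
Implicit Types (s : state R) (X Y : nat -> 'rV['F_2]_n) (c : nat -> 'F_2).

Definition rep s arr N X :=
  forall i (j : 'I_n), (i < N)%N -> nmem s arr (i * n + j) = X i 0 j.

Definition repc s N c := forall i, (i < N)%N -> nmem s aRHS i = c i.

(** The part of the memory that is read-only once [offset_prog] has run. *)
Record env s : Prop := Env {
  env_n : nmem s 0 0 = n;
  env_m : nmem s 0 1 = m;
  env_k : nmem s 0 2 = k;
  env_off : forall i, (i < m + n)%N -> nmem s aOFFSET i = (i * n)%N;
  env_A : rep s 1 (m + n) A1;
  env_b : forall i, (i < m + n)%N -> nmem s 2 i = c0 i;
  env_w : forall i, (i < m)%N -> rmem s 0 i = W i }.

Lemma env_agree Ws Wr s s1 : agree Ws Wr s s1 ->
  [&& 0 \notin Ws, 1 \notin Ws, 2 \notin Ws & 4 \notin Ws]%N -> 0%N \notin Wr ->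
  env s -> env s1.
Proof.
move=> [h hr] /and4P[w0 w1 w2 w4] wr [e0 e1 e2 e3 e4 e5 e6].
split=> [||||i j|i|i]; rewrite ?h ?hr //; last exact: e6.
- by move=> i; rewrite h //; apply: e3.
- exact: e4.
- exact: e5.
Qed.

Lemma env_nset s x q v :
  x \notin [:: 0; 1; 2; aOFFSET]%N -> env s -> env (nset s x q v).
Proof.
rewrite !inE !negb_or => /and4P[x0 x1 x2 x4].
apply: (env_agree (Ws := [:: x]) (Wr := [::])) => //.
  by apply: agree_nset; rewrite inE.
by rewrite !inE ![_ == x]eq_sym x0 x1 x2 x4.
Qed.

Lemma rep_agree Ws Wr s s1 arr N X : agree Ws Wr s s1 -> arr \notin Ws ->
  rep s arr N X -> rep s1 arr N X.
Proof. by move=> [h _] aW r i j iN; rewrite h // r. Qed.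

Lemma repc_agree Ws Wr s s1 N c : agree Ws Wr s s1 -> aRHS \notin Ws ->
  repc s N c -> repc s1 N c.
Proof. by move=> [h _] aW r i iN; rewrite h // r. Qed.

(** The expression [v] may read the row being overwritten, as in [addrow_prog]; its value is
    therefore required only in states where the current cell still has its original content. *)
Lemma fill_row_spec arr v i (f : 'rV['F_2]_n) s :
  env s -> nmem s aI 0 = i -> (i < m + n)%N -> arr \notin [:: 0; aOFFSET; aI; aJ]%N ->
  (forall (j : 'I_n) s1, agree [:: aJ; arr] [::] s s1 -> nmem s1 aJ 0 = j ->
     nmem s1 arr (i * n + j) = nmem s arr (i * n + j) -> neval s1 v = f 0 j) ->
  forall i' (j : 'I_n),
    nmem (run (fill_row_prog arr v) s) arr (i' * n + j) =
    if i' == i then nat_of_ord (f 0 j) else nmem s arr (i' * n + j).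
Proof.
move=> e si iN; rewrite !inE !negb_or => /and4P[arr0 arrO arrI arrJ] hv.
pose I t s1 := forall i' (j : 'I_n), nmem s1 arr (i' * n + j) =
  if (i' == i) && (j < t)%N then nat_of_ord (f 0 j) else nmem s arr (i' * n + j).
suff : I n (run (fill_row_prog arr v) s).
  by move=> h i' j; rewrite h ltn_ord andbT.
apply: for_rule => /=.
- by rewrite env_n.
- by rewrite inE eq_sym.
- by move=> i' j; rewrite nsetE (negbTE arrJ) andbF.
move=> t s1 tn ag sJ ih i' j; rewrite !runE !nsetE (negbTE arrJ) /= eqxx /=.
have ag1 : nmem s1 aOFFSET i = (i * n)%N.
  by rewrite ag.1 ?(env_off e) // !inE ![_ == arr]eq_sym (negbTE arrO).
have agI : nmem s1 aI 0 = i.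
  by rewrite ag.1 // !inE ![_ == arr]eq_sym (negbTE arrI).
rewrite agI ag1 sJ cell_eq // [(j < t.+1)%N]ltnS leq_eqVlt.
case: (eqVneq i' i) => [->|ne] /=; last by rewrite ih (negbTE ne).
case: (eqVneq (j : nat) t) => [jt|jt] /=.
  apply: (hv j s1 ag); first by rewrite sJ.
  by rewrite ih eqxx jt ltnn.
by rewrite ih eqxx.
Qed.

Lemma copy_spec src dst ex N X s :
  env s -> neval s ex = N -> (N <= m + n)%N ->
  dst \notin [:: 0; 1; 2; aOFFSET; aI; aJ]%N -> src \notin [:: aI; aJ; dst] ->
  rep s src N X -> rep (run (copy_prog src dst ex) s) dst N X.
Proof.
move=> e exN NN; rewrite !inE !negb_or => /and5P[d0 d1 d2 dO /andP[dI dJ]].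
move=> /and3P[sI sJ sd] rX.
pose I t s1 := rep s1 dst t X.
apply: (for_rule (I := I)) => //=.
- by rewrite !inE negb_or ![_ == dst]eq_sym dI.
move=> t s1 tN ag sI1 ih i j it; rewrite nsetE (negbTE dI) /=.
rewrite (fill_row_spec (i := t) (f := X t)) //.
- by case: eqP => [->//|/eqP ne]; rewrite ih // ltn_neqAle ne.
- apply: env_agree ag _ _ e => //.
  by rewrite !inE /= ![_ == dst]eq_sym ?negb_or d0 d1 d2 dO.
- exact: leq_trans tN NN.
- by rewrite !inE !negb_or d0 dO dI dJ.
move=> j' s2 ag2 sJ' _ /=; have ag12 : agree [:: aI; aJ; dst] [::] s s2.
  apply: agree_trans ag _; apply: agree_sub ag2 => // z.
  by rewrite !inE => /orP[]->; rewrite ?orbT.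
have -> : nmem s2 aI 0 = t.
  by rewrite ag2.1 // !inE ![_ == dst]eq_sym (negbTE dI).
have -> : nmem s2 aOFFSET t = (t * n)%N.
  rewrite ag12.1 ?(env_off e) ?(leq_trans tN NN) //.
  by rewrite !inE ![_ == dst]eq_sym (negbTE dO).
by rewrite sJ' ag12.1 ?rX // !inE !negb_or sI sJ.
Qed.

Lemma offset_spec s : nmem s 0 0 = n ->
  nmem s 0 1 = m -> nmem s aOFFSET 0 = 0%N ->
  forall i, (i <= m + n)%N -> nmem (run offset_prog s) aOFFSET i = (i * n)%N.
Proof.
move=> sn sm s0.
pose I t s1 := forall i, (i <= t)%N -> nmem s1 aOFFSET i = (i * n)%N.
apply: (for_rule (I := I)) => //=.
- by rewrite sn sm.
- by move=> i; rewrite leqn0 => /eqP->; rewrite nsetE.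
move=> t s1 tN ag st ih i; rewrite !runE !nsetE /= st ih // ag.1 // sn addn1.
case: eqP => [->|ne] it; first by rewrite mulSn addnC.
by apply: ih; lia.
Qed.

(* Rows [m + j] of the working matrix start as unit vectors with right-hand
   side 0, so that their right-hand sides record the change of variables. *)
Definition ext_rows i : 'rV['F_2]_n :=
  if (i < m)%N then A1 i else \row_j ((i == m + j)%N)%:R.

Lemma init_spec s : env s -> (forall i, (m <= i)%N -> A1 i = 0) ->
  rep (run init_prog s) aMAT (m + n) ext_rows /\ repc (run init_prog s) (m + n) c0.
Proof.
move=> e A0; rewrite /init_prog; set q1 := PFor aI _ _; set q3 := PFor aJ _ _.
have e1 : env (run q1 s) by apply: env_agree (run_agree _ _) _ _ e.
have c1 : repc (run q1 s) (m + n) c0.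
  apply: (for_rule (I := fun t s1 => repc s1 t c0)) => //=.
    by rewrite (env_n e) (env_m e).
  move=> t s1 tN ag st ih i it; rewrite !runE !nsetE /= st ag.1 //.
  case: eqP => [->|ne]; first by rewrite (env_b e).
  by apply: ih; lia.
have r2 : rep (run (copy_prog 1 aMAT Vmn) (run q1 s)) aMAT (m + n) A1.
  apply: copy_spec => //; first by rewrite /= (env_n e1) (env_m e1).
  exact: env_A e1.
have e2 : env (run (copy_prog 1 aMAT Vmn) (run q1 s)).
  by apply: env_agree (run_agree _ _) _ _ e1.
have c2 : repc (run (copy_prog 1 aMAT Vmn) (run q1 s)) (m + n) c0.
  by apply: repc_agree (run_agree _ _) _ c1.
rewrite !runE; move: (run (copy_prog _ _ _) _) e2 c2 r2 => s2 e2 c2 r2.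
split; last by apply: repc_agree (run_agree _ _) _ c2.
pose I t s1 := forall i (j : 'I_n), (i < m + n)%N -> nmem s1 aMAT (i * n + j) =
  (if (i < m + t)%N then ext_rows i 0 j else A1 i 0 j) :> nat.
suff: I n (run q3 s2) by move=> h i j im; rewrite h // im.
apply: for_rule => //=.
- by rewrite (env_n e2).
- move=> i j im; rewrite nsetE /= r2 // addn0 /ext_rows.
  by case: (i < m)%N.
move=> t s1 tn ag st ih i j im; have e3 : env s1 by apply: env_agree ag _ _ e2.
rewrite !runE !nsetE /= (env_m e3) st (env_off e3) ?ltn_add2l // cell_eq //.
have -> : (i < m + t.+1)%N = (i == m + t)%N || (i < m + t)%N.
  by rewrite addnS ltnS leq_eqVlt.
rewrite ih //; case: (eqVneq i (m + t)%N) => [->|ne] //=.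
rewrite ltnn /ext_rows ltnNge leq_addr /= mxE eqn_add2l eq_sym.
by case: eqP => //= _; rewrite A0 ?leq_addr // mxE.
Qed.

Lemma pivot_spec s X a : env s -> rep s aMAT (m + n) X ->
  nmem s aA 0 = a -> (a < m + n)%N ->
  (nmem (run pivot_prog s) aPIV 0 = n /\ X a = 0) \/
  exists2 p : 'I_n, nmem (run pivot_prog s) aPIV 0 = p & X a 0 p = 1.
Proof.
move=> e r sa am.
pose I t s1 :=
  (nmem s1 aPIV 0 = n /\ forall j : 'I_n, (j < t)%N -> X a 0 j = 0) \/
  exists2 p : 'I_n, nmem s1 aPIV 0 = p & X a 0 p = 1.
suff : I n (run pivot_prog s).
  case=> [[h1 h2]|h]; [left; split=> //|by right].
  by apply/rowP => j; rewrite h2 // mxE.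
rewrite /pivot_prog !runE; apply: for_rule => //=.
- by rewrite nsetE /= (env_n e).
- by left; split=> //; rewrite !nsetE /= (env_n e).
move=> t s1 tn ag st ih; have e1 : env s1.
  by apply: env_agree ag _ _ _ => //; apply: env_nset.
have r1 : rep s1 aMAT (m + n) X.
  by apply: rep_agree ag _ _ => // i j im; rewrite nsetE /= r.
have sa1 : nmem s1 aA 0 = a by rewrite ag.1 //= nsetE.
rewrite !runE /= sa1 (env_off e1) // st; have := r1 _ (Ordinal tn) am => /= ->.
case: (F2P (X a 0 (Ordinal tn))) => h; rewrite h /=.
  case: ih => [[h1 h2]|[p h1 h2]]; last by right; exists p.
  left; split=> // j; rewrite ltnS leq_eqVlt => /orP[/eqP jt|]; last exact: h2.
  by rewrite -[RHS]h; congr (X a 0 _); apply: val_inj.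
by right; exists (Ordinal tn) => //; rewrite !nsetE.
Qed.

Lemma eqrow_spec s X N src dst a b : env s -> rep s src N X ->
  src \notin [:: aJ; dst] -> dst \notin [:: 0; 1; 2; aOFFSET; aJ; aA; aB]%N ->
  (N <= m + n)%N -> nmem s aA 0 = a -> (a < N)%N ->
  nmem s aB 0 = b -> (b < N)%N ->
  nmem (run (eqrow_prog src dst) s) dst 0 = (X a == X b).
Proof.
move=> e r; rewrite !inE !negb_or => /andP[sJ sd].
move=> /and5P[d0 d1 d2 dO /and3P[dJ dA dB]] NN sa aN sb bN.
pose I t s1 :=
  nmem s1 dst 0 = [forall j : 'I_n, (j < t)%N ==> (X a 0 j == X b 0 j)].
suff : I n (run (eqrow_prog src dst) s).
  move=> ->; congr nat_of_bool; apply/forallP/eqP => [h|-> j];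
    last by rewrite eqxx implybT.
  by apply/rowP => j; have := h j; rewrite ltn_ord => /eqP.
have es : env (nset s dst 0 1).
  by apply: env_nset; rewrite // !inE !negb_or d0 d1 d2 dO.
rewrite /eqrow_prog !runE; apply: for_rule => //=.
- by rewrite (env_n es).
- by rewrite !inE ![_ == dst]eq_sym.
- rewrite /I !nsetE (negbTE dJ) /= !eqxx /=.
  by have -> : [forall j : 'I_n, true] by apply/forallP.
move=> t s1 tn ag st ih; have e1 : env s1.
  apply: env_agree ag _ _ es; rewrite ?inE //=.
  by rewrite ![_ == dst]eq_sym d0 d1 d2 dO.
have r1 : rep s1 src N X.
  apply: rep_agree ag _ _; first by rewrite !inE negb_or sJ.
  by move=> i j im; rewrite nsetE (negbTE sd) /= r.
have sa1 : nmem s1 aA 0 = a.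
  by rewrite ag.1 ?nsetE ?inE ?negb_or /= eq_sym (negbTE dA).
have sb1 : nmem s1 aB 0 = b.
  by rewrite ag.1 ?nsetE ?inE ?negb_or /= eq_sym (negbTE dB).
have aM := leq_trans aN NN; have bM := leq_trans bN NN.
rewrite !runE /= sa1 sb1 !(env_off e1) // st.
have := r1 _ (Ordinal tn) aN => /= ->; have := r1 _ (Ordinal tn) bN => /= ->.
rewrite -eqn_leq /I nsetE (negbTE dJ) /=.
case: ifP => h.
  rewrite ih; congr nat_of_bool; apply/forallP/forallP => H j; apply/implyP.
    rewrite ltnS leq_eqVlt => /orP[/eqP jt|jt]; last by have := H j; rewrite jt.
    by have -> : j = Ordinal tn by apply: val_inj.
  by move=> jt; have := H j; rewrite ltnS (ltnW jt).
rewrite nsetE !eqxx /=; case: forallP => // H.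
by have := H (Ordinal tn); rewrite /= ltnSn /= -val_eqE /= h.
Qed.

Lemma saverow_spec s X a : env s -> rep s aMAT (m + n) X ->
  nmem s aA 0 = a -> (a < m + n)%N ->
  forall j : 'I_n, nmem (run saverow_prog s) aROW j = X a 0 j.
Proof.
move=> e r sa am.
pose I t s1 := forall j : 'I_n, (j < t)%N -> nmem s1 aROW j = X a 0 j.
suff : I n (run saverow_prog s) by move=> h j; apply: h.
apply: for_rule => //=; first by rewrite (env_n e).
move=> t s1 tn ag st ih j jt; rewrite !runE !nsetE /= st.
have e1 : env s1 by apply: env_agree ag _ _ e.
rewrite (ag.1 aA) // sa (env_off e1) // (ag.1 aMAT) //.
case: eqP => [<-|ne]; first by rewrite r.
by apply: ih; lia.
Qed.

Lemma gain_spec s X c a : env s -> rep s aMAT (m + n) X -> repc s (m + n) c ->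
  nmem s aA 0 = a -> (a < m)%N ->
  rmem (run gain_prog s) 1 0 = gain m W X c a.
Proof.
move=> e r rc sa am; rewrite /gain_prog !runE /=; set s0 := rset _ _ _ _.
have e0 : env s0.
  by apply: env_agree (run_agree (PR 1 (NConst 0) (RSub rvar rvar)) s) _ _ e.
pose I t s1 := rmem s1 1 0 =
  \sum_(0 <= i < t) (if X i == X a then signed (c i + c a) (W i) else 0).
suff : I m (run (PFor aB Vm
    (eqrow_prog aMAT aEQM ;;
     PIf (NLe (NConst 1) (var aEQM))
       (PIf (NEq (NGet aRHS (var aB)) (NGet aRHS (var aA)))
          (PR 1 (NConst 0) (RAdd rvar (RGet 0 (var aB))))
          (PR 1 (NConst 0) (RSub rvar (RGet 0 (var aB)))))
       PSkip)) s0).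
  by move=> ->; rewrite big_mkord -big_mkcond.
apply: for_rule => //=.
- by rewrite (env_m e0).
- by rewrite /I big_geq // /s0 rsetE /= subrr.
move=> t s1 tm ag st ih; rewrite run_seq.
have e1 : env s1 by apply: env_agree ag _ _ e0.
have tM : (t < m + n)%N by lia.
have aM : (a < m + n)%N by lia.
have r1 : rep s1 aMAT (m + n) X by apply: rep_agree ag _ r.
have sa1 : nmem s1 aA 0 = a by rewrite ag.1.
have EXE : nmem (run (eqrow_prog aMAT aEQM) s1) aEQM 0 = (X a == X t).
  by apply: (eqrow_spec (N := m + n)).
have g2 : rmem (run (eqrow_prog aMAT aEQM) s1) 1 0 = rmem s1 1 0.
  by rewrite run_rframe.
have w2 : rmem (run (eqrow_prog aMAT aEQM) s1) 0 t = W t.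
  by rewrite run_rframe // (env_w e1).
have ca : nmem (run (eqrow_prog aMAT aEQM) s1) aRHS a = c a.
  by rewrite run_nframe // ag.1 // rc.
have ct : nmem (run (eqrow_prog aMAT aEQM) s1) aRHS t = c t.
  by rewrite run_nframe // ag.1 // rc.
have a2 : nmem (run (eqrow_prog aMAT aEQM) s1) aA 0 = a by rewrite run_nframe.
have b2 : nmem (run (eqrow_prog aMAT aEQM) s1) aB 0 = t by rewrite run_nframe.
move: (run _ s1) EXE g2 w2 ca ct a2 b2 => s2 EXE g2 w2 ca ct a2 b2.
rewrite /I big_nat_recr //= -ih -g2 !runE /= EXE a2 b2 ca ct -eqn_leq w2 eq_sym.
case: (X t == X a) => /=; last by rewrite addr0.
rewrite /signed F2_addr_eq0 val_eqE.
by case: (c t == c a).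
Qed.

Lemma bit_spec s X c a : repc s (m + n) c -> nmem s aA 0 = a -> (a < m)%N ->
  rmem s 1 0 = gain m W X c a ->
  nmem (run bit_prog s) aBIT 0 = elim_bit m W X c a.
Proof.
move=> rc sa am g; rewrite !runE /= g subrr sa rc; last by lia.
rewrite /elim_bit; case: ifP => _; rewrite nsetE //=.
by case: (F2P (c a)) => ->.
Qed.

Lemma addrow_spec s X c a (p : 'I_n) (b : 'F_2) :
  env s -> rep s aMAT (m + n) X -> repc s (m + n) c ->
  (forall j : 'I_n, nmem s aROW j = X a 0 j) -> nmem s aPIV 0 = p ->
  nmem s aBIT 0 = b ->
  rep (run addrow_prog s) aMAT (m + n) (elim_rows X a p) /\
  repc (run addrow_prog s) (m + n) (fun i => c i + X i 0 p * b).
Proof.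
move=> e r rc rR sp sb.
pose I t s1 :=
  rep s1 aMAT (m + n) (fun i => if (i < t)%N then elim_rows X a p i else X i)
  /\ repc s1 (m + n) (fun i => if (i < t)%N then c i + X i 0 p * b else c i).
suff : I (m + n)%N (run addrow_prog s).
  by case=> h1 h2; split=> [i j im|i im]; rewrite ?h1 ?h2 // im.
apply: for_rule => //=; first by rewrite (env_n e) (env_m e).
move=> t s1 tN ag st [ih1 ih2].
have e1 : env s1 by apply: env_agree ag _ _ e.
have sp1 : nmem s1 aPIV 0 = p by rewrite ag.1.
have sb1 : nmem s1 aBIT 0 = b by rewrite ag.1.
rewrite !runE /= st (env_off e1) // sp1 ih1 // ltnn.
have ltS i : (i < t.+1)%N = (i == t) || (i < t)%N by rewrite ltnS leq_eqVlt.
case: (F2P (X t 0 p)) => h; rewrite h /=.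
  split=> [i j im|i im]; rewrite nsetE /= ?ih1 ?ih2 // ltS.
    by case: eqP => [->|//]; rewrite ltnn /elim_rows h scale0r addr0.
  by case: eqP => [->|//]; rewrite ltnn h mul0r addr0.
rewrite sb1; set s2 := nset s1 _ _ _.
have e2 : env s2 by apply: env_nset.
split=> [i j im|i im].
  rewrite nsetE /= (fill_row_spec (i := t) (f := X t + X a)) //.
  - rewrite ltS; case: eqP => [->|_] /=; last by rewrite /s2 nsetE /= ih1.
    by rewrite /elim_rows h scale1r.
  - move=> j' s3 ag3 sj sx /=; rewrite sj (ag3.1 aI) // /s2 nsetE /= st.
    rewrite (ag3.1 aOFFSET) // (env_off e2) // sx (ag3.1 aROW) // /s2 !nsetE /= ih1 // ltnn ag.1 // rR.
    by rewrite mxE F2_val_add.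
rewrite nsetE /= run_nframe // /s2 nsetE /= ih2 // ltnn.
rewrite ltS; case: eqP => [->|_]; last by rewrite ih2.
by rewrite h mul1r F2_val_add.
Qed.

Lemma elim_spec s X c a : env s -> rep s aMAT (m + n) X -> repc s (m + n) c ->
  nmem s aA 0 = a -> (a < m)%N -> exists X' c',
  [/\ elim_step m W X c a X' c', rep (run elim_prog s) aMAT (m + n) X'
    & repc (run elim_prog s) (m + n) c'].
Proof.
move=> e r rc sa am; have aM : (a < m + n)%N by lia.
rewrite /elim_prog run_seq run_if /=.
have := pivot_spec e r sa aM.
have e1 : env (run pivot_prog s) by apply: env_agree (run_agree _ _) _ _ e.
have r1 : rep (run pivot_prog s) aMAT (m + n) X.
  by apply: rep_agree (run_agree _ _) _ r.
have c1 : repc (run pivot_prog s) (m + n) c.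
  by apply: repc_agree (run_agree _ _) _ rc.
have a1 : nmem (run pivot_prog s) aA 0 = a by rewrite run_nframe.
move: (run pivot_prog s) e1 r1 c1 a1 => s1 e1 r1 c1 a1.
rewrite (env_n e1); case=> [[-> Xa]|[p sp Xp]].
  by rewrite leqnn run_skip; exists X, c; split=> //; left.
rewrite sp -ltnNge ltn_ord 3!run_seq.
have rr := saverow_spec e1 r1 a1 aM.
have e2 : env (run saverow_prog s1) by apply: env_agree (run_agree _ _) _ _ e1.
have r2 : rep (run saverow_prog s1) aMAT (m + n) X.
  by apply: rep_agree (run_agree _ _) _ r1.
have c2 : repc (run saverow_prog s1) (m + n) c.
  by apply: repc_agree (run_agree _ _) _ c1.
have a2 : nmem (run saverow_prog s1) aA 0 = a by rewrite run_nframe.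
have p2 : nmem (run saverow_prog s1) aPIV 0 = p by rewrite run_nframe.
move: (run saverow_prog s1) e2 r2 c2 a2 p2 rr => s2 e2 r2 c2 a2 p2 rr.
have g3 := gain_spec e2 r2 c2 a2 am.
have e3 : env (run gain_prog s2) by apply: env_agree (run_agree _ _) _ _ e2.
have r3 : rep (run gain_prog s2) aMAT (m + n) X.
  by apply: rep_agree (run_agree _ _) _ r2.
have c3 : repc (run gain_prog s2) (m + n) c.
  by apply: repc_agree (run_agree _ _) _ c2.
have a3 : nmem (run gain_prog s2) aA 0 = a by rewrite run_nframe.
have b4 := bit_spec c3 a3 am g3.
have e4 : env (run bit_prog (run gain_prog s2)).
  by apply: env_agree (run_agree _ _) _ _ e3.
have [||||r5 c5] := @addrow_spec _ X c a p _ e4 _ _ _ _ b4.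
- by apply: rep_agree (run_agree _ _) _ r3.
- by apply: repc_agree (run_agree _ _) _ c3.
- by move=> j; rewrite !run_nframe // rr.
- by rewrite !run_nframe.
exists (elim_rows X a p), (elim_rhs m W X c a p); split=> //.
by right; exists p.
Qed.

Lemma eligible_spec s X Y a : env s -> rep s aMAT (m + n) X -> rep s aOLD m Y ->
  nmem s aA 0 = a -> (a < m)%N ->
  nmem (run eligible_prog s) aELIG 0 =
  ((X a != 0) && [forall b : 'I_m, (X a == X b) ==> (Y a == Y b)]).
Proof.
move=> e r rY sa am; have aM : (a < m + n)%N by lia.
rewrite /eligible_prog 2!run_seq; set q := PIf (NLt _ _) _ _.
have := pivot_spec e r sa aM.
have e1 : env (run pivot_prog s) by apply: env_agree (run_agree _ _) _ _ e.
have r1 : rep (run pivot_prog s) aMAT (m + n) X.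
  by apply: rep_agree (run_agree _ _) _ r.
have y1 : rep (run pivot_prog s) aOLD m Y.
  by apply: rep_agree (run_agree _ _) _ rY.
have a1 : nmem (run pivot_prog s) aA 0 = a by rewrite run_nframe.
move: (run pivot_prog s) e1 r1 y1 a1 => s1 e1 r1 y1 a1 piv.
have ok2 : nmem (run q s1) aELIG 0 = (X a != 0).
  rewrite /q !runE /= (env_n e1); case: piv => [[-> ->]|[p -> Xp]].
    by rewrite leqnn eqxx nsetE.
  rewrite -ltnNge ltn_ord nsetE /=; case: eqP => // Xa.
  by move: Xp; rewrite Xa mxE => /eqP; rewrite eq_sym oner_eq0.
have e2 : env (run q s1) by apply: env_agree (run_agree _ _) _ _ e1.
have r2 : rep (run q s1) aMAT (m + n) X.
  by apply: rep_agree (run_agree _ _) _ r1.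
have y2 : rep (run q s1) aOLD m Y by apply: rep_agree (run_agree _ _) _ y1.
have a2 : nmem (run q s1) aA 0 = a by rewrite run_nframe.
move: (run q s1) e2 r2 y2 a2 ok2 => s2 e2 r2 y2 a2 ok2 {q}.
pose P t := [forall b : 'I_m, (b < t)%N ==> ((X a == X b) ==> (Y a == Y b))].
pose I t s3 := nmem s3 aELIG 0 = ((X a != 0) && P t).
set q := PFor _ _ _; suff -> : I m (run q s2).
  by congr (nat_of_bool (_ && _)); apply: eq_forallb => b; rewrite ltn_ord.
apply: for_rule => //=.
- by rewrite (env_m e2).
- rewrite /I nsetE /= ok2.
  by have -> : P 0%N; [apply/forallP|rewrite andbT].
move=> t s3 tm ag st ih; rewrite 2!run_seq.
have e3 : env s3 by apply: env_agree ag _ _ e2.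
have a3 : nmem s3 aA 0 = a by rewrite ag.1.
have tM : (t < m + n)%N by lia.
have PS : P t.+1 = P t && ((X a == X t) ==> (Y a == Y t)).
  apply/forallP/andP => [H|[/forallP H1 H2] b].
    split; last by have := H (Ordinal tm); rewrite /= ltnSn.
    by apply/forallP => b; apply/implyP => bt; have := H b;
      rewrite ltnS (ltnW bt).
  rewrite ltnS leq_eqVlt; apply/implyP => /orP[/eqP->//|bt].
  by have := H1 b; rewrite bt.
have EXE : nmem (run (eqrow_prog aMAT aEQM) s3) aEQM 0 = (X a == X t).
  by apply: (eqrow_spec (N := m + n)) => //; apply: rep_agree ag _ r2.
have EYE : nmem (run (eqrow_prog aOLD aEQO) (run (eqrow_prog aMAT aEQM) s3)) aEQO 0 = (Y a == Y t).
  apply: (eqrow_spec (N := m)) => //; rewrite ?run_nframe //; last by lia.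
    by apply: env_agree (run_agree _ _) _ _ e3.
  by apply: rep_agree (run_agree _ _) _ _ => //; apply: rep_agree ag _ y2.
have EXE' : nmem (run (eqrow_prog aOLD aEQO) (run (eqrow_prog aMAT aEQM) s3)) aEQM 0 = (X a == X t).
  by rewrite run_nframe.
have ok4 : nmem (run (eqrow_prog aOLD aEQO) (run (eqrow_prog aMAT aEQM) s3)) aELIG 0 = nmem s3 aELIG 0.
  by rewrite !run_nframe.
move: (run (eqrow_prog aOLD aEQO) _) EXE' EYE ok4 => s4 EXE' EYE ok4.
rewrite /I nsetE /= PS !runE /= EXE' EYE.
case: (X a == X t); case: (Y a == Y t) => //=;
  rewrite ?andbT ?andbF ?ok4 ?ih //.
Qed.

(** The array is in order of choice, whereas [greedy] lists the last chosen row first; hence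
    [rev]. *)
Definition rep_list s L :=
  nmem s aLEN 0 = size L /\
  forall q, (q < size L)%N -> nmem s aLIST q = nth 0%N (rev L) q.

Lemma rep_list_agree Ws Wr s s1 L : agree Ws Wr s s1 ->
  (aLEN \notin Ws) && (aLIST \notin Ws) -> rep_list s L -> rep_list s1 L.
Proof.
by move=> [h _] /andP[w1 w2] [r1 r2]; split=> [|q qL]; rewrite h // r2.
Qed.

Lemma round_spec s X c : env s -> rep s aMAT (m + n) X -> repc s (m + n) c ->
  exists L X' c',
  [/\ rep (run round_prog s) aMAT (m + n) X', repc (run round_prog s) (m + n) c',
      rep_list (run round_prog s) L & [/\ reach X L X', greedy m X L, (size L <= k)%N
    & size L = k \/ forall a, (a < m)%N -> stuck m X L a]].
Proof.
move=> e r rc; rewrite /round_prog 2!run_seq; set q := copy_prog _ _ _.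
set s0 := run (PN _ _ _) s; set q3 := PFor _ _ _.
have e0 : env s0 by apply: env_agree (run_agree _ _) _ _ e.
have r0 : rep s0 aMAT (m + n) X by apply: rep_agree (run_agree _ _) _ r.
have y1 : rep (run q s0) aOLD m X.
  apply: copy_spec => //=; [by rewrite (env_m e0)|by lia|].
  by move=> i j im; apply: r0; lia.
have l0 : nmem (run q s0) aLEN 0 = 0%N by rewrite run_nframe // /s0 runE nsetE.
have e1 : env (run q s0) by apply: env_agree (run_agree _ _) _ _ e0.
have r1 : rep (run q s0) aMAT (m + n) X.
  by apply: rep_agree (run_agree _ _) _ r0.
have rc0 : repc s0 (m + n) c by apply: repc_agree (run_agree _ _) _ rc.
have c1 : repc (run q s0) (m + n) c by apply: repc_agree (run_agree _ _) _ rc0.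
move: (run q s0) y1 l0 e1 r1 c1 => s1 y1 l0 e1 r1 c1 {q s0 e0 r0 rc0}.
pose I t s2 := exists L X' c',
  [/\ rep s2 aMAT (m + n) X', repc s2 (m + n) c',
      rep_list s2 L & [/\ reach X L X', greedy m X L, (size L <= k)%N
    & size L = k \/ forall a, (a < t)%N -> stuck m X L a]].
suff : I m (run q3 s1) by [].
apply: for_rule => //=.
- by rewrite (env_m e1).
- exists [::], X, c; split=> //.
  by split=> //; [apply: reach_nil|right].
move=> t s2 tm ag st [L [X' [c' [r2 c2 l2 [rL gL Lk done]]]]].
have e2 : env s2 by apply: env_agree ag _ _ e1.
have y2 : rep s2 aOLD m X by apply: rep_agree ag _ y1.
have frame s3 : I t.+1 s3 -> I t.+1 (nset s3 aA 0 t.+1).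
  by case=> [L3 [X3 [c3 h3]]]; exists L3, X3, c3.
apply: frame; rewrite run_if /= (env_k e2) l2.1.
case: leqP => Lk' /=.
  rewrite run_skip; exists L, X', c'; split=> //; split=> //.
  by left; apply/eqP; rewrite eqn_leq Lk Lk'.
have {}done a : (a < t)%N -> stuck m X L a.
  by case: done => [h|]; [rewrite h ltnn in Lk'|apply].
rewrite run_seq; have := eligible_spec e2 r2 y2 st tm.
have e3 : env (run eligible_prog s2) by apply: env_agree (run_agree _ _) _ _ e2.
have r3 : rep (run eligible_prog s2) aMAT (m + n) X'.
  by apply: rep_agree (run_agree _ _) _ r2.
have c3 : repc (run eligible_prog s2) (m + n) c'.
  by apply: repc_agree (run_agree _ _) _ c2.
have l3 : rep_list (run eligible_prog s2) L.
  by apply: rep_list_agree (run_agree _ _) _ l2.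
have a3 : nmem (run eligible_prog s2) aA 0 = t by rewrite run_nframe.
move: (run eligible_prog s2) e3 r3 c3 l3 a3 => s3 e3 r3 c3 l3 a3 ok.
rewrite run_if /= ok; case: ifP => ok'; last first.
  rewrite run_skip; exists L, X', c'; split=> //; split=> //; right=> a.
  rewrite ltnS leq_eqVlt => /orP[/eqP->|]; last exact: done.
  (* Failure of the test means being stuck: row [t] is zero modulo the span, or congruent to a row
     that differs from it in [X]. *)
  move: ok'; rewrite lt0b => /negbT; rewrite negb_and negbK => /orP[|].
    by rewrite (reach_eq0 _ rL); left.
  rewrite negb_forall => /existsP[b]; rewrite negb_imply => /andP[h1 h2].
  right; exists b; split=> //; first by rewrite -(reach_eq _ _ rL) eq_sym.
  by move=> h; rewrite h eqxx in h2.
move: ok'; rewrite lt0b => /andP[t0 /forallP tU].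
rewrite 2!run_seq; set s4 := run (PN aLEN _ _) _.
have ag34 : agree [:: aLIST; aLEN] [::] s3 s4.
  apply: agree_trans (agree_sub _ _ (run_agree _ _)) (agree_sub _ _ (run_agree _ _)) => // z;
  by rewrite !inE => ->; rewrite ?orbT.
have l4 : rep_list s4 (t :: L).
  rewrite /s4 !runE; split; first by rewrite nsetE /= nsetE /= l3.1 addn1.
  move=> q; rewrite nsetE /= nsetE /= l3.1 a3 ltnS leq_eqVlt rev_cons nth_rcons size_rev.
  by case: eqP => [->|ne] /=; rewrite ?ltnn ?eqxx // => qL; rewrite qL l3.2.
have e4 : env s4 by apply: env_agree ag34 _ _ e3.
have a4 : nmem s4 aA 0 = t by rewrite ag34.1.
have r4 : rep s4 aMAT (m + n) X' by apply: rep_agree ag34 _ r3.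
have c4 : repc s4 (m + n) c' by apply: repc_agree ag34 _ c3.
have [X5 [c5 [st5 r5 c5']]] := elim_spec e4 r4 c4 a4 tm.
exists (t :: L), X5, c5; split=> //.
  by apply: rep_list_agree (run_agree _ _) _ l4.
split=> //.
- exact: elim_step_reach st5 rL.
- split=> //; first by rewrite -(reach_eq0 _ rL).
  move=> b bm; rewrite -(reach_eq _ _ rL) => h.
  by have := tU (Ordinal bm); rewrite /= eq_sym h => /eqP.
(* The row just picked lies in the new span, and the earlier rows remain stuck. *)
right=> a; rewrite ltnS leq_eqVlt => /orP[/eqP->|/done]; last exact: stuck_cons.
by left; rewrite mem_rspan_cons F2_mx_addxx mem0v orbT.
Qed.

(** * Correctness of the search and of the main program *)

Section Main.
Hypothesis A1_out : forall i, (m <= i)%N -> A1 i = 0.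
Hypothesis A1_full : forall U : {vspace 'rV['F_2]_n},
  (forall i, (i < m)%N -> A1 i \in U) -> (n <= \dim U)%N.
Hypothesis A1_neq0 : forall i, (i < m)%N -> A1 i != 0.
Hypothesis A1_inj :
  forall i j, (i < m)%N -> (j < m)%N -> A1 i = A1 j -> i = j.
Hypotheses (k_ge2 : (2 <= k)%N) (m_small : (m.+2 ^ k.-1 <= 2 ^ n)%N).

Lemma ext_rows_lt i : (i < m)%N -> ext_rows i = A1 i.
Proof. by rewrite /ext_rows => ->. Qed.

Lemma search_spec s : env s -> rep s aMAT (m + n) ext_rows ->
  repc s (m + n) c0 -> nmem s aLEN 0 = 0%N -> exists L,
  [/\ size L = k, rep_list (run search_prog s) L, sum_free m ext_rows L
    & forall a, a \in L -> (a < m)%N].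
Proof.
move=> e r rc l0.
pose found s1 := exists L, [/\ size L = k, rep_list s1 L,
  sum_free m ext_rows L & forall a, a \in L -> (a < m)%N].
pose I t s1 := found s1 \/ exists X c,
  [/\ rep s1 aMAT (m + n) X, repc s1 (m + n) c, (nmem s1 aLEN 0 < k)%N
    & search_inv m ext_rows k t X].
have full (U : {vspace 'rV['F_2]_n}) :
    (forall i, (i < m)%N -> ext_rows i \in U) -> (n <= \dim U)%N.
  by move=> h; apply: A1_full => i im; rewrite -ext_rows_lt ?h.
suff : I n (run search_prog s).
  (* The search invariant is impossible after [n] rounds, so a list has been found. *)
  by case=> // [[X [c [_ _ _ /(search_inv_n k_ge2 m_small)]]]].
apply: for_rule => //=.
- by rewrite (env_n e).
- right; exists ext_rows, c0; split=> //; last exact: search_inv0.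
  by rewrite nsetE /= l0; lia.
move=> t s1 tn ag st ih; have e1 : env s1 by apply: env_agree ag _ _ e.
have frame s3 : I t.+1 s3 -> I t.+1 (nset s3 aT 0 t.+1) by [].
apply: frame; rewrite run_if /= (env_k e1) -ltnNge.
case: ih => [fd|[X [c [r1 c1 lk iX]]]].
  by have [L [Lk [-> _] _ _]] := fd; rewrite Lk ltnn run_skip; left.
rewrite lk; have [L [X' [c' [r2 c2 l2 [rL gL Lk dn]]]]] := round_spec e1 r1 c1.
have [sk|/eqP sk] := eqVneq (size L) k.
  left; exists L; split=> //; last by move=> a; apply: mem_greedy gL.
  (* The list is greedy in a quotient of the initial rows; these are distinct, so it is sum-free
     among them. *)
  case: iX => G [_ [T [XE _]] _]; apply: greedy_sum_free XE _ gL => i j im jm.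
  by rewrite !ext_rows_lt //; apply: A1_inj.
right; exists X', c'; split=> //; first by rewrite l2.1; lia.
apply: (search_step full k_ge2 m_small iX rL gL); first by lia.
by case: dn.
Qed.

Variable wmin : R.
Hypotheses (wmin_ge0 : 0 <= wmin) (W_ge : forall i, (i < m)%N -> wmin <= W i).

Lemma satisfy_spec s L : env s -> rep s aMAT (m + n) ext_rows ->
  repc s (m + n) c0 -> size L = k -> rep_list s L -> sum_free m ext_rows L ->
  (forall a, a \in L -> (a < m)%N) -> exists X c y,
  [/\ rep (run satisfy_prog s) aMAT (m + n) X, repc (run satisfy_prog s) (m + n) c,
      affine_inv ext_rows c0 X c y & k%:R * wmin <= potential m W X c].
Proof.
move=> e r rc Lk [_ rL] sL Lm.
have W0 i : (i < m)%N -> 0 <= W i by move=> im; apply: le_trans (W_ge im).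
(* The list is processed in order of choice, so after [t] rounds its last [t] entries have been
   eliminated. *)
pose I t s1 := exists X c y,
  [/\ rep s1 aMAT (m + n) X, repc s1 (m + n) c, affine_inv ext_rows c0 X c y &
      reach ext_rows (drop (k - t) L) X /\ t%:R * wmin <= potential m W X c].
suff : I k (run satisfy_prog s).
  by case=> X [c [y [h1 h2 h3 [_ h4]]]]; exists X, c, y.
apply: for_rule => //=.
- by rewrite (env_k e).
- exists ext_rows, c0, 0; split=> //; first exact: affine_inv0.
  split; first by rewrite subn0 -Lk drop_size; apply: reach_nil.
  (* No row is zero at the start: the potential is an empty sum. *)
  rewrite mul0r /potential big_pred0 // => i.
  by rewrite ext_rows_lt // (negbTE (A1_neq0 _)).
move=> t s1 tk ag st [X [c [y [r1 c1 aff [rX pot]]]]].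
have e1 : env s1 by apply: env_agree ag _ _ e.
have frame s3 : I t.+1 s3 -> I t.+1 (nset s3 aQ 0 t.+1) by [].
apply: frame; rewrite run_seq run_nset /= st ag.1 // rL ?Lk //.
rewrite nth_rev ?Lk //; set a := nth _ _ _; set s2 := nset _ _ _ _.
have kt : (k - t.+1 < size L)%N by rewrite Lk; lia.
have am : (a < m)%N by apply: Lm; rewrite mem_nth.
have e2 : env s2 by apply: env_nset.
have a2 : nmem s2 aA 0 = a by rewrite nsetE.
have [X' [c' [stp r' c'']]] := @elim_spec s2 X c a e2 r1 c1 a2 am.
have dE : drop (k - t.+1) L = a :: drop (k - t) L.
  by rewrite (drop_nth 0%N) //; congr (_ :: drop _ _); lia.
have [|rX' potE] := elim_step_sum_free W0 am _ rX stp.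
  by rewrite -dE; apply: sum_free_drop.
have [y' aff'] := elim_step_affine stp aff.
exists X', c', y'; split=> //; rewrite dE; split=> //.
by rewrite potE -natr1 mulrDl mul1r lerD // W_ge.
Qed.

(** These eliminations may use any row: the choice of the bit keeps the potential from dropping, and
    in the end every equation is decided. *)
Lemma finish_spec s X c y B : env s -> rep s aMAT (m + n) X ->
  repc s (m + n) c -> affine_inv ext_rows c0 X c y -> B <= potential m W X c ->
  exists X' c' y',
  [/\ repc (run finish_prog s) (m + n) c', affine_inv ext_rows c0 X' c' y',
      B <= potential m W X' c' & forall a, (a < m)%N -> X' a = 0].
Proof.
move=> e r rc aff pot.
pose I t s1 := exists X c y,
  [/\ rep s1 aMAT (m + n) X, repc s1 (m + n) c, affine_inv ext_rows c0 X c y &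
      B <= potential m W X c /\ forall a, (a < t)%N -> X a = 0].
suff : I m (run finish_prog s).
  by case=> X1 [c1 [y1 [h1 h2 h3 [h4 h5]]]]; exists X1, c1, y1.
apply: for_rule => //=.
- by rewrite (env_m e).
- by exists X, c, y; split.
move=> t s1 tm ag st [X1 [c1 [y1 [r1 rc1 aff1 [pot1 z1]]]]].
have e1 : env s1 by apply: env_agree ag _ _ e.
have frame s3 : I t.+1 s3 -> I t.+1 (nset s3 aA 0 t.+1) by [].
apply: frame; have [X' [c' [stp r' c'']]] := elim_spec e1 r1 rc1 st tm.
have [y' aff'] := elim_step_affine stp aff1.
exists X', c', y'; split=> //; split.
  exact: le_trans pot1 (elim_step_potential stp).
move=> a; rewrite ltnS leq_eqVlt => /orP[/eqP->|/z1];
  first exact: elim_step_self stp.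
exact: elim_step_zero stp.
Qed.

Lemma output_spec s c : env s -> repc s (m + n) c ->
  forall j : 'I_n, nmem (run output_prog s) 3 j = c (m + j)%N.
Proof.
move=> e rc.
pose I t s1 := forall j : 'I_n, (j < t)%N -> nmem s1 3 j = c (m + j)%N.
suff : I n (run output_prog s) by move=> h j; apply: h.
apply: for_rule => //=; first by rewrite (env_n e).
move=> t s1 tn ag st ih j jt; rewrite !runE !nsetE /= st.
have e1 : env s1 by apply: env_agree ag _ _ e.
rewrite (env_m e1) (ag.1 aRHS) //.
case: eqP => [<-|ne]; first by rewrite rc // ltn_add2l.
by apply: ih; lia.
Qed.

Lemma main_spec s :
  nmem s 0 0 = n -> nmem s 0 1 = m -> nmem s 0 2 = k -> nmem s aOFFSET 0 = 0%N ->
  nmem s aLEN 0 = 0%N -> rep s 1 (m + n) A1 ->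
  (forall i, (i < m + n)%N -> nmem s 2 i = c0 i) ->
  (forall i, (i < m)%N -> rmem s 0 i = W i) ->
  exists X c y,
  [/\ affine_inv ext_rows c0 X c y, forall a, (a < m)%N -> X a = 0,
      k%:R * wmin <= potential m W X c
    & forall j : 'I_n, nmem (run main_prog s) 3 j = c (m + j)%N].
Proof.
move=> sn sm sk so sl sA sb sw; rewrite /main_prog.
have e1 : env (run offset_prog s).
  split=> [||||i j im|i im|i im]; rewrite ?run_nframe ?run_rframe //.
  - by move=> i im; rewrite offset_spec // ltnW.
  - exact: sA.
  - exact: sb.
  - exact: sw.
rewrite run_seq; have l1 : nmem (run offset_prog s) aLEN 0 = 0%N.
  by rewrite run_nframe.
move: (run offset_prog s) e1 l1 => s1 e1 l1.
rewrite run_seq; have [r2 c2] := init_spec e1 A1_out.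
have e2 : env (run init_prog s1) by apply: env_agree (run_agree _ _) _ _ e1.
have l2 : nmem (run init_prog s1) aLEN 0 = 0%N by rewrite run_nframe.
move: (run init_prog s1) e2 l2 r2 c2 => s2 e2 l2 r2 c2.
rewrite run_seq; have [L [Lk l3 sL Lm]] := search_spec e2 r2 c2 l2.
have e3 : env (run search_prog s2) by apply: env_agree (run_agree _ _) _ _ e2.
move: (run search_prog s2) e3 l3 => s3 e3 l3.
rewrite run_seq; have [r4 c4] := init_spec e3 A1_out.
have e4 : env (run init_prog s3) by apply: env_agree (run_agree _ _) _ _ e3.
have l4 : rep_list (run init_prog s3) L.
  by apply: rep_list_agree (run_agree _ _) _ l3.
move: (run init_prog s3) e4 l4 r4 c4 => s4 e4 l4 r4 c4.
rewrite run_seq; have [X5 [c5 [y5 [r5 rc5 aff5 pot5]]]] :=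
  satisfy_spec e4 r4 c4 Lk l4 sL Lm.
have e5 : env (run satisfy_prog s4) by apply: env_agree (run_agree _ _) _ _ e4.
move: (run satisfy_prog s4) e5 r5 rc5 => s5 e5 r5 rc5.
rewrite run_seq; have [X6 [c6 [y6 [rc6 aff6 pot6 z6]]]] :=
  finish_spec e5 r5 rc5 aff5 pot5.
have e6 : env (run finish_prog s5) by apply: env_agree (run_agree _ _) _ _ e5.
exists X6, c6, y6; split=> //.
exact: output_spec e6 rc6.
Qed.

End Main.
End Specs.

(** * The theorem *)

Section System.
Variables (R : realType) (n m : nat) (S : lin_system R n m).

Definition sys_row i : 'rV['F_2]_n :=
  if (insub i : option 'I_m) is Some i' then row i' (lhs S) else 0.
Definition sys_rhs i : 'F_2 :=
  if (insub i : option 'I_m) is Some i' then rhs S i' 0 else 0.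
Definition sys_weight i : R :=
  if (insub i : option 'I_m) is Some i' then weight S i' else 0.

Lemma sys_rowE (i : 'I_m) : sys_row i = row i (lhs S).
Proof. by rewrite /sys_row valK. Qed.

Lemma sys_rhsE (i : 'I_m) : sys_rhs i = rhs S i 0.
Proof. by rewrite /sys_rhs valK. Qed.

Lemma sys_weightE (i : 'I_m) : sys_weight i = weight S i.
Proof. by rewrite /sys_weight valK. Qed.

Lemma sys_row_full (U : {vspace 'rV['F_2]_n}) : \rank (lhs S) = n ->
  (forall i, (i < m)%N -> sys_row i \in U) -> (n <= \dim U)%N.
Proof.
move=> rk h; have full : row_full (lhs S) by rewrite /row_full rk.
have dE : \dim {: 'rV['F_2]_n} = n by rewrite dimvf /dim /= mul1n.
rewrite -{1}dE; apply: dimvS; apply/subvP => v _.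
have /submxP[D ->] := submx_full v full.
rewrite mulmx_sum_row; apply: memv_suml => i _; apply: memvZ.
by rewrite -sys_rowE; apply: h.
Qed.

(** For an equation [i], [c i] is its right-hand side plus its left-hand side at [y], hence 0
    exactly when [y] satisfies it. *)
Lemma excess_potential X c y :
  affine_inv (ext_rows m sys_row) sys_rhs X c y ->
  (forall i, (i < m)%N -> X i = 0) ->
  excess S y = potential m sys_weight X c.
Proof.
case=> T [_ cE] X0; rewrite /excess /potential [RHS](eq_bigl xpredT);
  last first.
  by move=> i; rewrite X0 ?eqxx.
have satE (i : 'I_m) : satisfied S y i = (c i == 0).
  rewrite cE ext_rows_lt // sys_rowE sys_rhsE -row_mul mxE F2_addr_eq0.
  by rewrite eq_sym.
rewrite [RHS](bigID (satisfied S y)) /= -sumrN; congr (_ + _).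
  by apply: eq_bigr => i; rewrite satE /signed sys_weightE => ->.
by apply: eq_bigr => i; rewrite satE /signed sys_weightE => /negbTE->.
Qed.

(** Row [m + j] starts as the unit vector [j] with right-hand side 0, so its right-hand side records
    coordinate [j] of the translation. *)
Lemma affine_inv_output X c y (j : 'I_n) :
  affine_inv (ext_rows m sys_row) sys_rhs X c y -> c (m + j)%N = y j 0.
Proof.
case=> T [_ ->]; rewrite /sys_rhs insubF ?add0r;
  last by rewrite ltnNge leq_addr.
rewrite /ext_rows ltnNge leq_addr /= mxE (bigD1 j) //= big1 ?addr0.
  by rewrite mxE eqxx mul1r.
by move=> i ij; rewrite mxE eqn_add2l val_eqE eq_sym (negbTE ij) mul0r.
Qed.

End System.

(** The inequality m + 2 <= 2^(n/(k-1)) is raised to the power k - 1. *)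
Lemma powR_bound_nat (R : realType) (n m k : nat) : (2 <= k)%N ->
  m%:R <= 2%:R `^ (n%:R / (k%:R - 1)) - 2%:R :> R -> (m.+2 ^ k.-1 <= 2 ^ n)%N.
Proof.
case: k => [|[|k]] // _; rewrite -[k.+2%:R]natr1 addrK /= lerBrDr -natrD addn2.
move=> h; rewrite -(ler_nat R) !natrX.
apply: le_trans (_ : (2 `^ (n%:R / k.+1%:R)) ^+ k.+1 <= _).
  by rewrite lerXn2r ?nnegrE ?powR_ge0.
by rewrite -powR_mulrn ?powR_ge0 // -powRrM divfK ?pnatr_eq0 // powR_mulrn.
Qed.

Lemma main_prog_correct (R : realType) n m (S : lin_system R n m) wmin k :
  positive_weights S -> irreducible S -> is_min_weight S wmin ->
  (2 <= k)%N -> (k <= m)%N ->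
  m%:R <= 2%:R `^ (n%:R / (k%:R - 1)) - 2%:R :> R ->
  exists (t : nat) (s : state R) (z : 'cV['F_2]_n),
    [/\ exec (compile main_prog) (input_state S k) t s,
        (t <= cost (m + m) main_prog)%N, outputs s z & k%:R * wmin <= excess S z].
Proof.
move=> pw [rk nz inj] [[i0 wi0] wmin_le] k2 km /(powR_bound_nat k2) ms.
have nm : (n <= m)%N by rewrite -rk rank_leq_row.
(* For n = 0 the bound would read (m+2)^(k-1) <= 1. Positivity serves to decode the row-major
   indices of the input. *)
have n0 : (0 < n)%N.
  rewrite lt0n; apply: contraTneq ms => ->; rewrite expn0 -ltnNge.
  by apply: (@leq_trans (m.+2 ^ 1)) => //; rewrite leq_exp2l //; lia.
pose s0 := input_state S k.
have [||||||||||||||X [c [y [aff X0 pot out]]]] :=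
  @main_spec R n m k (sys_row S) (sys_rhs S) (sys_weight S) _ _ _ _ k2 ms wmin _ _ s0 => //.
- by move=> i mi; rewrite /sys_row insubF // ltnNge mi.
- by move=> U; apply: sys_row_full.
- by move=> i im; rewrite (sys_rowE S (Ordinal im)).
- move=> i j im jm; rewrite (sys_rowE S (Ordinal im)) (sys_rowE S (Ordinal jm)).
  by move/inj => [].
- by rewrite -wi0 ltW.
- by move=> i im; rewrite (sys_weightE S (Ordinal im)).
- move=> i j im; rewrite /s0 /input_state /nmem divnMDl // divn_small // addn0.
  rewrite modnMDl modn_small // valK /sys_row; case: insubP => [i' _ _|_].
    by rewrite mxE.
  by rewrite mxE.
- by move=> i im; rewrite /s0 /input_state /nmem /sys_rhs; case: insubP.
have [||t tM ex] := @exec_compile R (m + m) main_prog s0.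
- exact: main_prog_wf.
- rewrite /bounded /= /s0 /nmem /=.
  by do !(apply/andP; split=> //); lia.
exists t, (run main_prog s0), y; split=> //.
- by move=> j; rewrite out (affine_inv_output _ aff).
- by rewrite (excess_potential aff X0).
Qed.

Lemma excess_le_max (R : realType) n m (S : lin_system R n m) z :
  excess S z <= max_excess S.
Proof. by rewrite /max_excess (bigD1 z) //= le_max lexx. Qed.

Theorem theorem2 (R : realType) :
  (forall (n m : nat) (S : lin_system R n m) (wmin : R) (k : nat),
      positive_weights S -> irreducible S -> is_min_weight S wmin ->
      (2 <= k)%N -> (k <= m)%N ->
      m%:R <= 2%:R `^ (n%:R / (k%:R - 1)) - 2%:R :> R ->
      k%:R * wmin <= max_excess S)
  /\
  (exists (P : cmd) (c : nat),
    forall (n m : nat) (S : lin_system R n m) (wmin : R) (k : nat),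
      positive_weights S -> irreducible S -> is_min_weight S wmin ->
      (2 <= k)%N -> (k <= m)%N ->
      m%:R <= 2%:R `^ (n%:R / (k%:R - 1)) - 2%:R :> R ->
      exists (t : nat) (s : state R) (z : 'cV['F_2]_n),
        [/\ exec P (input_state S k) t s,
            (t <= m ^ c)%N,
            outputs s z
          & k%:R * wmin <= excess S z]).
Proof.
split=> [n m S wmin k pw irr mw k2 km ms|].
  have [_ [_ [z [_ _ _ h]]]] := main_prog_correct pw irr mw k2 km ms.
  exact: le_trans h (excess_le_max S z).
have [c hc] := cost_poly main_prog; exists (compile main_prog), c.
move=> n m S wmin k pw irr mw k2 km ms.
have [t [s [z [ex tc out h]]]] := main_prog_correct pw irr mw k2 km ms.
exists t, s, z; split=> //; apply: leq_trans tc _.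
by apply: hc; apply: leq_trans km.
Qed.
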